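(* Fix a constant $\delta \in (0,1)$. There are constants $c, c' > 0$, independent of $\delta$ and $n$, such that for all sufficiently large $n$ there exists a binary matrix $A \in \{0,1\}^{m \times n}$ that can be explicitly constructed (i.e., in time polynomial in $n$) and has the following properties: (i) the number of rows (the sketch length) is $m = c\sqrt{\delta}\,\log(1/\delta)\cdot n$; (ii) $A$ has $c'\log(1/\delta)\cdot n$ nonzero entries; (iii) there exist reals $C_1, C_2 > 0$, independent of $n$, such that for all $\eta \geq 0$, the $(C_1, C_2)$-approximate sparse recovery problem for $A$ with sparsity $\delta n$, noise $\eta$ and $\ell_1/\ell_1$-guarantee is solved by the $\ell_1$-minimization algorithm.
   Context: A vector is $s$-sparse if it has at most $s$ nonzero coordinates. For $\bm{x} \in \mathbb{R}^n$ and $q \ge 1$, $\sigma_s(\bm{x})_q = \min\{\|\bm{x}-\bm{z}\|_q : \bm{z} \text{ is } s\text{-sparse}\}$. Approximate sparse recovery: fix reals $C_1, C_2 > 0$, a matrix $A \in \mathbb{R}^{m\times n}$, an integer $s \ge 1$ and a real $\eta \ge 0$. The $(C_1,C_2)$-approximate sparse recovery problem for $A$ with sparsity $s$, noise $\eta$ and $\ell_1/\ell_1$-guarantee is: given $\bm{y} \in \mathbb{R}^m$ with $\bm{y} = A\bm{x} + \bm{e}$, where $\bm{x} \in \mathbb{R}^n$ and the error vector $\bm{e}$ are unknown and $\|\bm{e}\|_1 < \eta$, find $\bm{z} \in \mathbb{R}^n$ with $\|\bm{z}-\bm{x}\|_1 \le C_1\,\sigma_s(\bm{x})_1 + C_2\,\eta$.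 This must hold for every such $\bm{x}$ and $\bm{e}$. The $\ell_1$-minimization algorithm outputs a minimizer $\bm{z}$ of $\|\bm{z}\|_1$ subject to $\|\bm{y} - A\bm{z}\|_1 < \eta$.
   Formalization: c, c' are uniform over δ in (0, δ1] for each fixed δ1 < 1 (uniformity on all of (0,1) fails as δ → 1); m and the nonzero count equal the stated real values up to any relative error ε > 0 from below; recovery is also proved with non-strict constraints, where a minimizer exists. *)

(* Defs.v *)
From HB Require Import structures.
From mathcomp Require Import all_boot all_order all_algebra.
From mathcomp Require Import all_classical all_reals all_analysis.

Set Implicit Arguments.
Unset Strict Implicit.
Unset Printing Implicit Defensive.

Import Order.TTheory GRing.Theory Num.Theory.

Local Open Scope classical_set_scope.
Local Open Scope ring_scope.

Section SparseRecovery.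
Variable R : realType.

Definition l1norm (n : nat) (x : 'cV[R]_n) : R := \sum_(i < n) `|x i 0|.

Definition sparse (n s : nat) (x : 'cV[R]_n) : Prop :=
  (#|[pred i : 'I_n | (x i 0 != 0)%R]| <= s)%N.

(* sigma_s(x)_1; the infimum is attained, by keeping the s largest entries. *)
Definition sigma1 (n s : nat) (x : 'cV[R]_n) : R :=
  inf [set l1norm (x - z) | z in [set z | sparse s z]].

Definition binary_mx (m n : nat) (A : 'M[R]_(m, n)) : Prop :=
  forall i j, (A i j == 0) || (A i j == 1).

Definition nnz (m n : nat) (A : 'M[R]_(m, n)) : nat :=
  #|[pred p : 'I_m * 'I_n | A p.1 p.2 != 0]|.

(* [cmp] is <%R or <=%R: the comparison used in the residual constraint. *)
Definition l1_minimizer (cmp : rel R) (m n : nat) (A : 'M[R]_(m, n))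
    (eta : R) (y : 'cV[R]_m) (z : 'cV[R]_n) : Prop :=
  cmp (l1norm (y - A *m z)) eta /\
  forall w : 'cV[R]_n, cmp (l1norm (y - A *m w)) eta -> l1norm z <= l1norm w.

Definition l1l1_guarantee (C1 C2 : R) (n s : nat) (eta : R)
    (x z : 'cV[R]_n) : Prop :=
  l1norm (z - x) <= C1 * sigma1 s x + C2 * eta.

Definition l1_outputs_valid (cmp : rel R) (C1 C2 : R) (m n : nat)
    (A : 'M[R]_(m, n)) (s : nat) (eta : R) : Prop :=
  forall (x : 'cV[R]_n) (e : 'cV[R]_m), cmp (l1norm e) eta ->
  forall z, l1_minimizer cmp A eta (A *m x + e) z ->
  l1l1_guarantee C1 C2 s eta x z.

Definition l1_output_exists (cmp : rel R) (m n : nat)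
    (A : 'M[R]_(m, n)) (eta : R) : Prop :=
  forall (x : 'cV[R]_n) (e : 'cV[R]_m), cmp (l1norm e) eta ->
  exists z, l1_minimizer cmp A eta (A *m x + e) z.

(* With the strict constraint the feasible set is open, so its only possible
   minimizer is 0 (lemma [strict_l1_minimizer_eq0] below) and there is in
   general none; eta = 0 is moreover excluded by |e|_1 < eta.  Hence the first
   clause, with strict inequalities, can only ask that every output be valid;
   the other two require the full property (an output exists, and every output
   is valid) of the closed problem, where |e|_1 <= eta and the constraint is
   |y - A z|_1 <= eta. *)
Definition solved_by_l1_minimization (C1 C2 : R) (m n : nat)
    (A : 'M[R]_(m, n)) (s : nat) (eta : R) : Prop :=
  [/\ l1_outputs_valid <%R C1 C2 A s eta,
      l1_output_exists <=%R A eta &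
      l1_outputs_valid <=%R C1 C2 A s eta].

(* k equals v up to relative error eps, and does not exceed it.  An exact
   rounding such as k = floor(a n), with a = c sqrt(delta) log(1/delta), is not
   achievable by an algorithm whose input is n: for a non-computable real delta
   it would make the real number a computable. *)
Definition eq_upto (eps : R) (k : nat) (v : R) : Prop :=
  (1 - eps) * v <= k%:R <= v.

Lemma l1normD n (x y : 'cV[R]_n) : l1norm (x + y) <= l1norm x + l1norm y.
Proof.
rewrite /l1norm -big_split /=; apply: ler_sum => i _.
by rewrite mxE ler_normD.
Qed.

Lemma l1normZ n a (x : 'cV[R]_n) : l1norm (a *: x) = `|a| * l1norm x.
Proof.
rewrite /l1norm mulr_sumr; apply: eq_bigr => i _.
by rewrite mxE normrM.
Qed.

Lemma l1norm_ge0 n (x : 'cV[R]_n) : 0 <= l1norm x.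
Proof. by apply: sumr_ge0 => i _. Qed.

Lemma l1norm_eq0 n (x : 'cV[R]_n) : l1norm x = 0 -> x = 0.
Proof.
move=> /eqP; rewrite psumr_eq0 => [/allP x0|i _]; last exact: normr_ge0.
apply/colP => i; rewrite mxE; apply/eqP; rewrite -normr_eq0.
by have := x0 i; rewrite mem_index_enum; apply.
Qed.

Lemma strict_l1_minimizer_eq0 m n (A : 'M[R]_(m, n)) eta y z :
  l1_minimizer <%R A eta y z -> z = 0.
Proof.
move=> [/= fz minz].
set r := eta - l1norm (y - A *m z).
have r0 : 0 < r by rewrite subr_gt0.
set b := l1norm (A *m z).
have b0 : 0 <= b by exact: l1norm_ge0.
have D0 : 0 < r + b + 1 by rewrite ltr_wpDl// addr_ge0// ltW.
set t := r / (r + b + 1).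
have t0 : 0 < t by rewrite divr_gt0.
have t1 : t <= 1.
  by rewrite ler_pdivrMr// mul1r -addrA lerDl addr_ge0.
have tb : t * b < r.
  rewrite /t mulrAC ltr_pdivrMr// ltr_pM2l//.
  by rewrite addrAC ltrDr ltr_wpDl// ltW.
have fw : l1norm (y - A *m ((1 - t) *: z)) < eta.
  have -> : y - A *m ((1 - t) *: z) = (y - A *m z) + t *: (A *m z).
    by rewrite -scalemxAr scalerBl scale1r opprB addrCA addrC -addrA
      [- _ + _]addrC addrA.
  apply: le_lt_trans (l1normD _ _) _.
  by rewrite l1normZ gtr0_norm// -/b -ltrBrDl.
have := minz _ fw; rewrite l1normZ ger0_norm ?subr_ge0//.
rewrite mulrBl mul1r lerDl oppr_ge0 pmulr_rle0// => z0.
by apply: l1norm_eq0; apply/le_anti; rewrite z0 l1norm_ge0.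
Qed.

End SparseRecovery.

(* Random-access machines, as structured programs over finitely many named
   arrays of natural numbers.  Every command and every test costs one unit: the
   expressions of a program have bounded size, and as the only arithmetic is
   addition and truncated subtraction, the bit length of the values grows at
   most linearly in the number of steps.  Hence polynomial time in this model
   coincides with polynomial time on Turing machines. *)

Definition store := nat -> nat -> nat.

Inductive expr : Type :=
| Const of nat
| Cell of nat & expr    (* Cell a e: the entry of array a at index e *)
| Plus of expr & expr
| Minus of expr & expr.

Inductive cmd : Type :=
| Skip
| Assign of nat & expr & expr    (* Assign a e f: a[e] := f *)
| Seq of cmd & cmd
| IfPos of expr & cmd & cmd
| WhilePos of expr & cmd.

Fixpoint eval (st : store) (e : expr) : nat :=
  match e with
  | Const k => k
  | Cell a e1 => st a (eval st e1)
  | Plus e1 e2 => (eval st e1 + eval st e2)%N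
  | Minus e1 e2 => (eval st e1 - eval st e2)%N
  end.

Definition update (st : store) (a i v : nat) : store :=
  fun a' i' => if (a' == a) && (i' == i) then v else st a' i'.

(* run c st t st': started in st, program c halts in st' after t steps. *)
Inductive run : cmd -> store -> nat -> store -> Prop :=
| RunSkip st : run Skip st 1 st
| RunAssign a e f st :
    run (Assign a e f) st 1 (update st a (eval st e) (eval st f))
| RunSeq c1 c2 st t1 st1 t2 st2 :
    run c1 st t1 st1 -> run c2 st1 t2 st2 ->
    run (Seq c1 c2) st (t1 + t2)%N st2
| RunIfTrue e c1 c2 st t st1 :
    (0 < eval st e)%N -> run c1 st t st1 -> run (IfPos e c1 c2) st t.+1 st1
| RunIfFalse e c1 c2 st t st1 :
    eval st e = 0%N -> run c2 st t st1 -> run (IfPos e c1 c2) st t.+1 st1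
| RunWhileFalse e c st :
    eval st e = 0%N -> run (WhilePos e c) st 1 st
| RunWhileTrue e c st t1 st1 t2 st2 :
    (0 < eval st e)%N -> run c st t1 st1 -> run (WhilePos e c) st1 t2 st2 ->
    run (WhilePos e c) st (t1 + t2).+1 st2.

(* The input n is in array 0 at index 0; all other cells are 0. *)
Definition input_store (n : nat) : store := update (fun _ _ => 0%N) 0 0 n.

(* The number of rows is in array 1 at index 0, and the entries of the matrix
   are in array 2, in row-major order. *)
Definition outputs_matrix (R : realType) (m n : nat) (st : store)
    (A : 'M[R]_(m, n)) : Prop :=
  st 1%N 0%N = m /\
  forall (i : 'I_m) (j : 'I_n), A i j = (st 2%N (i * n + j)%N)%:R.

(* One program computes A n from n, for all n >= n0, in time polynomial in n. *)
Definition poly_time_constructible (R : realType) (n0 : nat) (m : nat -> nat)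
    (A : forall n, 'M[R]_(m n, n)) : Prop :=
  exists (p : cmd) (k : nat), forall n, (n0 <= n)%N ->
  exists (t : nat) (st : store),
    [/\ run p (input_store n) t st, (t <= n ^ k + k)%N
      & outputs_matrix st (A n)].

(* Main.v *)
Require Import Defs.
From mathcomp Require Import all_boot all_order all_algebra.
From mathcomp Require Import all_classical all_reals all_analysis.
From mathcomp Require Import fintype finset ring lra zify.
Require Import Defs.

(** Coordinates are the edges [(v, w)] of an expander walk graph on
    [(F_2^2)^r]: [w] ranges over the words of length [2t] in eight letters, and
    the edge joins [v] on the left to [w(v)] on the right.  Every vertex, on
    either side, measures its [d = 8^(2t)] edges by the same constant-size local
    matrix, the adjacency matrix of a random lossless expander, which satisfies
    the null space property for [k ~ sqrt(2 delta) d] coordinates.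

    Given a set [S] of at most [delta n] edges, expander mixing shows that every
    subgraph of [S] has a vertex of degree at most [k].  Peeling such vertices
    off assigns each edge of [S] to one of its ends, each vertex receiving at
    most [k] edges; adding up the local inequalities over all vertices bounds
    [|x_S|_1] by [1/4 |x|_1 + tau |A x|_1], which gives the recovery guarantee.

    The spectral gap is proved by Walsh analysis: the generators act on the dual
    group, pairs of polynomials [(alpha, beta)] over [F_2], and an almost
    invariant measure cannot exist because [beta += alpha] and
    [beta += T alpha] move the regions defined by comparing degrees into each
    other.  Deleting columns and adding rows preserves the null space property,
    which adjusts the sizes for every [n]. *)

Set Implicit Arguments.
Unset Strict Implicit.
Unset Printing Implicit Defensive.

Import Order.TTheory GRing.Theory Num.Theory.
Import numFieldNormedType.Exports.

Local Open Scope ring_scope.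

(** * Walsh analysis and the Poincare inequality *)

Section Vertices.
Variable r : nat.
Notation vertex := {ffun 'I_r.+1 -> bool * bool}.

(** The degree [d] depends on [delta] but not on [n]. The local matrix may therefore come from a
    counting argument and be hard-wired into the program; only the graph has to be computed from
    [n], so no explicit lossless expander is needed. For large [n] there are [O(n / d)] vertices,
    each with [O(k log(1/delta))] local rows, and [k ~ sqrt(2 delta) d] makes
    [O(sqrt(delta) log(1/delta) n)] rows in all. The square root is the right scale: by mixing,
    edges of density [delta] can at worst crowd between fractions of order [sqrt(delta)] of the two
    sides, where degrees are of order [sqrt(delta) d]. A column lies in two local matrices, so it
    has [O(log(1/delta))] ones. Two obstacles shape the end of the proof. As [delta] tends to 1,
    [log(1/delta)] vanishes while local column weights do not, so the constants depend on an upper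
    bound [delta1 < 1]. And [delta] need not be computable, so it enters the program only through
    finitely many integers ([t], [ml], [q], [a1], [a3] and the local rows). *)

Definition digit (v : vertex) (j : nat) : bool * bool :=
  if insub j is Some i then v i else (false, false).

Definition swapv (v : vertex) : vertex := [ffun i => ((v i).2, (v i).1)].
Definition addv (v : vertex) : vertex :=
  [ffun i => ((v i).1 (+) (v i).2, (v i).2)].
(** A vertex is a pair of polynomials [(a, b)] of degree at most [r], and [digit] is zero past [r].
    This adds to [a] the quotient of [b] by [T], the transpose of the truncated multiplication by
    [T] in [shiftv_dual]. *)
Definition shiftv (v : vertex) : vertex :=
  [ffun i : 'I_r.+1 => ((v i).1 (+) (digit v i.+1).2, (v i).2)].
(** The only generator that is not linear. It multiplies a character by the sign of the top
    coefficient of [alpha], which controls the frequencies where multiplication by [T] overflows. *)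
Definition flipv (v : vertex) : vertex :=
  [ffun i => ((v i).1 (+) (i == ord_max), (v i).2)].

Definition addv_dual (u : vertex) : vertex :=
  [ffun i => ((u i).1, (u i).2 (+) (u i).1)].
Definition shiftv_dual (u : vertex) : vertex :=
  [ffun i : 'I_r.+1 =>
     ((u i).1, (u i).2 (+) ((0 < i)%N && (digit u i.-1).1))].

Lemma digitE (v : vertex) (i : 'I_r.+1) : digit v i = v i.
Proof. by rewrite /digit valK. Qed.

Lemma digit_out (v : vertex) j : (r < j)%N -> digit v j = (false, false).
Proof. by move=> h; rewrite /digit insubF // ltnS leqNgt h. Qed.

Lemma swapvK : involutive swapv.
Proof. by move=> v; apply/ffunP => i; rewrite !ffunE /=; case: (v i). Qed.

Lemma addvK : involutive addv.
Proof.
by move=> v; apply/ffunP => i; rewrite !ffunE /=; case: (v i) => [[] []].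
Qed.

Lemma digit_shiftv2 (v : vertex) j : (digit (shiftv v) j).2 = (digit v j).2.
Proof. by rewrite /digit; case: insubP => // i _ _; rewrite ffunE. Qed.

Lemma shiftvK : involutive shiftv.
Proof.
move=> v; apply/ffunP => i; rewrite !ffunE /= digit_shiftv2.
by case: (v i) => [a b] /=; case: (digit _ _).2; case: a.
Qed.

Lemma flipvK : involutive flipv.
Proof.
by move=> v; apply/ffunP => i; rewrite !ffunE /=; case: (v i) => [a b] /=;
  case: eqP; case: a.
Qed.

Lemma addv_dualK : involutive addv_dual.
Proof.
by move=> v; apply/ffunP => i; rewrite !ffunE /=; case: (v i) => [[] []].
Qed.

Lemma digit_shiftv_dual1 (v : vertex) j :
  (digit (shiftv_dual v) j).1 = (digit v j).1.
Proof. by rewrite /digit; case: insubP => // i _ _; rewrite ffunE. Qed.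

Lemma shiftv_dualK : involutive shiftv_dual.
Proof.
move=> v; apply/ffunP => i; rewrite !ffunE /= digit_shiftv_dual1.
by case: (v i) => [a b] /=; case: (_ && _); case: b.
Qed.

(* The degree, plus one, of a polynomial over F_2. *)
Definition psize (a : 'I_r.+1 -> bool) : nat := (\max_(i | a i) i.+1)%N.

Lemma psize_leP (a : 'I_r.+1 -> bool) m :
  reflect (forall i : 'I_r.+1, (m <= i)%N -> a i = false) (psize a <= m)%N.
Proof.
rewrite /psize; apply: (iffP (bigmax_leqP _ _ _)) => h i.
  by move=> mi; apply/negbTE/negP => /h; rewrite ltnNge mi.
by move=> ai; rewrite ltnNge; apply/negP => /h; rewrite ai.
Qed.

Lemma psize_lt (a : 'I_r.+1 -> bool) (i : 'I_r.+1) : a i -> (i < psize a)%N.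
Proof. by move=> ai; apply: (leq_bigmax_cond (F := fun i : 'I_r.+1 => i.+1)). Qed.

Lemma psizeP (a : 'I_r.+1 -> bool) : (0 < psize a)%N ->
  exists2 i : 'I_r.+1, a i & psize a = i.+1.
Proof.
move=> h; have [|i ai ei] := @eq_bigmax_cond _ a (fun i : 'I_r.+1 => i.+1).
  rewrite lt0n; apply: contraL h => /eqP /card0_eq h.
  by rewrite /psize big1 // => i; rewrite -[a i]/(i \in a) h.
by exists i.
Qed.

Let asz (u : vertex) := psize (fun i => (u i).1).
Let bsz (u : vertex) := psize (fun i => (u i).2).
Let top (u : vertex) := (u ord_max).1.

Lemma asz_bsz_eq0 u : asz u = 0%N -> bsz u = 0%N -> u = [ffun=> (false, false)].
Proof.
move=> /eqP; rewrite -leqn0 => /psize_leP a0 /eqP; rewrite -leqn0.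
move=> /psize_leP b0; apply/ffunP => i; rewrite ffunE.
by move: (a0 i (leq0n _)) (b0 i (leq0n _)); case: (u i) => [? ?] /= -> ->.
Qed.

Lemma asz_swap u : asz (swapv u) = bsz u.
Proof. by apply: eq_bigl => i; rewrite ffunE. Qed.
Lemma bsz_swap u : bsz (swapv u) = asz u.
Proof. by apply: eq_bigl => i; rewrite ffunE. Qed.
Lemma asz_add u : asz (addv_dual u) = asz u.
Proof. by apply: eq_bigl => i; rewrite ffunE. Qed.
Lemma asz_shift u : asz (shiftv_dual u) = asz u.
Proof. by apply: eq_bigl => i; rewrite ffunE. Qed.

Lemma bsz_add u : (bsz u < asz u)%N -> bsz (addv_dual u) = asz u.
Proof.
move=> lt; apply/eqP; rewrite eqn_leq; apply/andP; split.
  apply/psize_leP => i le; rewrite ffunE /=.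
  have /psize_leP/(_ i le) -> := leqnn (asz u).
  by have /psize_leP/(_ i (leq_trans (ltnW lt) le)) -> := leqnn (bsz u).
have [i ai ei] := psizeP (leq_ltn_trans (leq0n _) lt).
rewrite {1}/asz ei; apply: psize_lt; rewrite ffunE /= ai.
have /psize_leP/(_ i (leqnn _)) -> // : (bsz u <= i)%N.
by rewrite -ltnS -ei.
Qed.

(** The leading term of [beta + T alpha] is that of [T alpha]; [~~ top u] keeps it from being
    truncated away. *)
Lemma bsz_shift u : (bsz u <= asz u)%N -> (0 < asz u)%N -> ~~ top u ->
  (asz u < bsz (shiftv_dual u))%N.
Proof.
move=> le pos tp; have [i ai ei] := psizeP pos.
have ir : (i.+1 < r.+1)%N.
  rewrite ltn_neqAle ltn_ord andbT; apply: contra tp => /eqP ir.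
  by rewrite /top (_ : ord_max = i) //; apply: val_inj => /=; case: ir.
rewrite /asz ei; apply: (@psize_lt _ (Ordinal ir)); rewrite ffunE /=.
have -> : digit u i = u i by rewrite digitE.
by move: le; rewrite {1}/asz ei ai => /psize_leP/(_ (Ordinal ir) (leqnn _)) ->.
Qed.

Section Walsh.
Variable R : realFieldType.

Definition sgb (b : bool) : R := (-1) ^+ b.
Lemma sgb_add a b : sgb (a (+) b) = sgb a * sgb b.
Proof. exact: signr_addb. Qed.

Definition walsh (u v : vertex) : R :=
  \prod_i sgb (((u i).1 && (v i).1) (+) ((u i).2 && (v i).2)).

Lemma walsh_swap u v : walsh u (swapv v) = walsh (swapv u) v.
Proof. by apply: eq_bigr => i _; rewrite !ffunE /= addbC. Qed.

Lemma walsh_add u v : walsh u (addv v) = walsh (addv_dual u) v.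
Proof.
apply: eq_bigr => i _; rewrite !ffunE /=.
by case: (u i) => [[] []]; case: (v i) => [[] []].
Qed.

Lemma walsh_shift u v : walsh u (shiftv v) = walsh (shiftv_dual u) v.
Proof.
pose A i := sgb (((u i).1 && (v i).1) (+) ((u i).2 && (v i).2)).
have -> : walsh u (shiftv v) =
    \prod_i (A i * sgb ((digit u i).1 && (digit v i.+1).2)).
  apply: eq_bigr => i _; rewrite -sgb_add !ffunE /= digitE; congr sgb.
  by case: (u i) => [[] []]; case: (v i) => [[] []]; case: (digit _ _) => [[] []].
have -> : walsh (shiftv_dual u) v =
    \prod_i (A i * sgb ((0 < i)%N && (digit u i.-1).1 && (digit v i).2)).
  apply: eq_bigr => i _; rewrite -sgb_add !ffunE /= [digit v i]digitE.
  congr sgb; case: (_ && (digit _ _).1).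
    by case: (u i) => [[] []]; case: (v i) => [[] []].
  by case: (u i) => [[] []]; case: (v i) => [[] []].
rewrite !big_split /=; congr (_ * _).
(* Both boundary factors are trivial, the last because [digit v r.+1] is zero and the first because
   of the guard [0 < i]; the rest is a reindexing. *)
rewrite big_ord_recr big_ord_recl /= mul1r [digit v _]digit_out //=.
by rewrite andbF mulr1; apply: eq_bigr.
Qed.

Lemma walsh_flip u v : walsh u (flipv v) = sgb (top u) * walsh u v.
Proof.
rewrite /walsh (bigD1 ord_max) //= [in RHS](bigD1 ord_max) //= mulrA.
rewrite -sgb_add !ffunE eqxx; congr (sgb _ * _).
  by rewrite /top; case: (u _) => [[] []]; case: (v _) => [[] []].
by apply: eq_bigr => i /negbTE ne; rewrite ffunE ne addbF.
Qed.

Lemma walsh_orth v w :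
  \sum_u walsh u v * walsh u w = if v == w then #|{: vertex}|%:R else 0.
Proof.
pose G (c x y : bool * bool) : R := sgb ((c.1 && x.1) (+) (c.2 && x.2)) *
  sgb ((c.1 && y.1) (+) (c.2 && y.2)).
have -> : \sum_u walsh u v * walsh u w = \prod_i \sum_c G c (v i) (w i).
  rewrite bigA_distr_bigA; apply: eq_bigr => u _.
  by rewrite /walsh -big_split.
have GE x y : \sum_c G c x y = if x == y then 4 else 0.
  rewrite (eq_bigr (fun c => G (c.1, c.2) x y)); last by case.
  rewrite -(pair_bigA _ (fun a b => G (a, b) x y)) /=.
  rewrite !big_bool /G /sgb /=.
  by case: x y => [[] []] [[] []] /=; ring.
case: eqP => [->|ne].
  rewrite (eq_bigr (fun=> 4)); last by move=> i _; rewrite GE eqxx.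
  by rewrite prodr_const card_ord card_ffun card_prod card_bool card_ord natrX.
have [i ni] : exists i, v i != w i.
  apply/existsP; apply: contra_notT ne; rewrite negb_exists => /forallP h.
  by apply/ffunP => i; apply/eqP; move: (h i); rewrite negbK.
by rewrite (bigD1 i) //= GE (negbTE ni) mul0r.
Qed.

Definition wtrans (f : vertex -> R) (u : vertex) : R :=
  \sum_v f v * walsh u v.

Lemma wtransB f g u :
  wtrans (fun v => f v - g v) u = wtrans f u - wtrans g u.
Proof. by rewrite -sumrB; apply: eq_bigr => v _; rewrite mulrBl. Qed.

Lemma parseval f :
  \sum_u wtrans f u ^+ 2 = #|{: vertex}|%:R * \sum_v f v ^+ 2.
Proof.
transitivity (\sum_v \sum_w f v * f w * \sum_u walsh u v * walsh u w).
  under eq_bigr => u _ do rewrite expr2 /wtrans big_distrlr /=.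
  rewrite exchange_big /=; apply: eq_bigr => v _.
  rewrite exchange_big /=; apply: eq_bigr => w _.
  by rewrite mulr_sumr; apply: eq_bigr => u _; ring.
rewrite mulr_sumr; apply: eq_bigr => v _; rewrite (bigD1 v) //= [X in _ + X]big1; last first.
  by move=> w /negbTE ne; rewrite walsh_orth eq_sym ne mulr0.
by rewrite walsh_orth eqxx; ring.
Qed.

Lemma wtrans_comp (g h : vertex -> vertex) f u : involutive g ->
  (forall u v, walsh u (g v) = walsh (h u) v) ->
  wtrans (f \o g) u = wtrans f (h u).
Proof.
move=> gK gh; rewrite /wtrans (reindex_inj (inv_inj gK)) /=.
by apply: eq_bigr => v _; rewrite gK gh.
Qed.

Definition energy (f : vertex -> R) (g : vertex -> vertex) : R :=
  \sum_v (f v - f (g v)) ^+ 2.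

Lemma energy_ge0 f g : 0 <= energy f g.
Proof. by apply: sumr_ge0 => v _; rewrite sqr_ge0. Qed.

Let mass f (O : pred vertex) : R := \sum_(u | O u) wtrans f u ^+ 2.

(** The transform of [f \o g] is that of [f] moved by [h], so moving [O] by [h] changes its mass
    only through [f - f \o g], whose norm is the energy by Parseval. *)
Lemma mass_transfer (g h : vertex -> vertex) f (O O' : pred vertex) :
  involutive g -> injective h ->
  (forall u v, walsh u (g v) = walsh (h u) v) ->
  (forall u, O u -> O' (h u)) ->
  mass f O <= mass f O' + 1/18 * mass f predT
              + 19 * (#|{: vertex}|%:R * energy f g).
Proof.
move=> gK hI gh OO'.
(* Young's inequality; the weight [1/18] is such that the losses in [poincare] add up to half of the
   total mass. *)
have pq (p q : R) : p ^+ 2 <= (1 + 1/18) * q ^+ 2 + 19 * (p - q) ^+ 2.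
  by have := sqr_ge0 (18 * p - 19 * q); nra.
have h1 : mass f O <= (1 + 1/18) * \sum_(u | O u) wtrans f (h u) ^+ 2
   + 19 * \sum_(u | O u) (wtrans f u - wtrans f (h u)) ^+ 2.
  by rewrite !mulr_sumr -big_split; apply: ler_sum => u _; apply: pq.
have h2 : \sum_(u | O u) wtrans f (h u) ^+ 2 <= mass f O'.
  rewrite /mass [leRHS](reindex_inj hI) /= [leRHS](bigID O) /=.
  rewrite [X in _ <= X + _](eq_bigl O) => [|u].
    by rewrite lerDl sumr_ge0 // => u _; rewrite sqr_ge0.
  by case: (boolP (O u)) => [/OO' ->|_]; rewrite ?andbF.
have h3 : \sum_(u | O u) (wtrans f u - wtrans f (h u)) ^+ 2 <=
    #|{: vertex}|%:R * energy f g.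
  rewrite -parseval [leRHS](bigID O) /=.
  under eq_bigr => u _ do rewrite -(wtrans_comp f u gK gh) -wtransB.
  by rewrite lerDl sumr_ge0 // => u _; rewrite sqr_ge0.
have h4 : mass f O' <= mass f predT.
  by rewrite /mass [leRHS](bigID O') /= lerDl sumr_ge0 // => u _; rewrite sqr_ge0.
by lra.
Qed.

(** Let [P], [Q], [S] be the frequencies where the degree of [beta] is below, equal to or above that
    of [alpha]. Swapping sends [S] into [P], [beta += alpha] sends [P] into [Q], and
    [beta += T alpha] sends the nonzero part of [P] and [Q], off [top], into [S]. So up to errors
    [P + Q <= S <= P <= Q], which bounds [Q], then [P], then [S], by 2, 3 and 4 times [H / 18]. The
    total, [H / 2], is absorbed; the swap is used 4 times, whence [152 = 2 * 4 * 19]. *)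
Lemma poincare f : \sum_v f v = 0 ->
  \sum_v f v ^+ 2 <=
  152 * (energy f swapv + energy f addv + energy f shiftv + energy f flipv).
Proof.
move=> f0; set N := #|{: vertex}|%:R : R.
have N0 : 0 < N by rewrite ltr0n card_ffun card_prod card_bool card_ord expn_gt0.
set H := mass f predT.
have HE : H = N * \sum_v f v ^+ 2 by rewrite /H /mass parseval.
pose P u := (bsz u < asz u)%N; pose Q u := asz u == bsz u.
pose S u := (asz u < bsz u)%N.
have split_mass : H = mass f P + mass f Q + mass f S.
  rewrite /H /mass (bigID P) /= -addrA; congr (_ + _).
  rewrite (bigID Q) /=; congr (_ + _); apply: eq_bigl => u; rewrite /P /Q /S.
    by case: ltngtP.
  by case: ltngtP.
have top_mass : mass f top = N * energy f flipv / 4.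
  have -> : N * energy f flipv = \sum_u (wtrans f u - sgb (top u) * wtrans f u) ^+ 2.
    rewrite -parseval; apply: eq_bigr => u _; rewrite wtransB.
    congr ((_ - _) ^+ 2).
    rewrite /wtrans (reindex_inj (inv_inj flipvK)) mulr_sumr /=.
    by apply: eq_bigr => v _; rewrite flipvK walsh_flip; ring.
  rewrite (bigID top) /= [X in _ + X]big1 ?addr0; last first.
    by move=> u /negbTE ->; rewrite /sgb expr0 mul1r subrr expr0n.
  rewrite mulr_suml; apply: eq_bigr => u ->; rewrite /sgb expr1; by field.
have E1 := energy_ge0 f swapv; have E2 := energy_ge0 f addv.
have E3 := energy_ge0 f shiftv; have E4 := energy_ge0 f flipv.
have e1 : mass f S <= mass f P + 1/18 * H + 19 * (N * energy f swapv).
  apply: (mass_transfer _ swapvK (inv_inj swapvK) walsh_swap) => u.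
  by rewrite /S /P asz_swap bsz_swap.
have e2 : mass f P <= mass f Q + 1/18 * H + 19 * (N * energy f addv).
  apply: (mass_transfer _ addvK (inv_inj addv_dualK) walsh_add) => u.
  by rewrite /Q /P asz_add => /bsz_add ->.
have e3 : mass f P + mass f Q <=
    mass f S + 1/18 * H + 19 * (N * energy f shiftv) + N * energy f flipv / 4.
  have -> : mass f P + mass f Q =
    mass f (fun u => (bsz u <= asz u)%N && (0 < asz u)%N).
    rewrite /mass [RHS](bigID P) /=; congr (_ + _).
      apply: eq_bigl => u; rewrite /P; case: (ltngtP (bsz u) (asz u)) => //=;
        rewrite ?andbF //.
      by case: (asz u).
    (* The zero frequency belongs to [Q] but is fixed by the generators; it carries no mass because
       [f] has mean zero. *)
    rewrite (bigD1 ([ffun=> (false, false)] : vertex)) /=; last first.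
      by rewrite /Q /asz /bsz /psize !big1 // => i; rewrite ffunE.
    rewrite [wtrans _ _](_ : _ = 0) ?expr0n ?add0r; last first.
      rewrite -f0; apply: eq_bigr => v _; rewrite /walsh big1 ?mulr1 // => i _.
      by rewrite ffunE /= /sgb expr0.
    apply: eq_bigl => u; rewrite /P /Q; case: (ltngtP (bsz u) (asz u)) => //= eab; rewrite ?andbF //.
    rewrite andbT lt0n; congr (~~ _); apply/eqP/eqP => [->|a0].
      by rewrite /asz /psize big1 // => i; rewrite ffunE.
    by apply: asz_bsz_eq0; rewrite ?eab.
  rewrite -top_mass.
  have : mass f (fun u => [&& (bsz u <= asz u)%N, (0 < asz u)%N & ~~ top u]) <=
    mass f S + 1/18 * H + 19 * (N * energy f shiftv).
    apply: (mass_transfer _ shiftvK (inv_inj shiftv_dualK) walsh_shift) => u.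
    by move=> /and3P[h1 h2 h3]; rewrite /S asz_shift bsz_shift.
  suff: mass f (fun u => (bsz u <= asz u)%N && (0 < asz u)%N) <=
    mass f (fun u => [&& (bsz u <= asz u)%N, (0 < asz u)%N & ~~ top u]) + mass f top.
    by move=> *; lra.
  rewrite /mass [leLHS](bigID top) /= addrC; apply: lerD.
    by rewrite le_eqVlt; apply/orP; left; apply/eqP/eq_bigl => u; rewrite andbA.
  rewrite [leRHS](bigID (fun u => (bsz u <= asz u)%N && (0 < asz u)%N)) /=.
  rewrite (eq_bigl _ _ (fun u => andbC _ _)) lerDl sumr_ge0 // => u _.
  by rewrite sqr_ge0.
rewrite -(ler_pM2l N0) -HE.
have NE1 := mulr_ge0 (ltW N0) E1; have NE2 := mulr_ge0 (ltW N0) E2.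
have NE3 := mulr_ge0 (ltW N0) E3; have NE4 := mulr_ge0 (ltW N0) E4.
have -> : N * (152 * (energy f swapv + energy f addv + energy f shiftv +
    energy f flipv)) = 152 * (N * energy f swapv + N * energy f addv +
    N * energy f shiftv + N * energy f flipv) by ring.
by lra.
Qed.

End Walsh.
End Vertices.

(** * Expander mixing *)

Fixpoint words (t : nat) : seq (seq nat) :=
  if t is t'.+1 then [seq l :: w | l <- iota 0 8, w <- words t']
  else [:: [::]].

Lemma wordsS t : words t.+1 = [seq l :: w | l <- iota 0 8, w <- words t].
Proof. by []. Qed.

Lemma size_words t : size (words t) = (8 ^ t)%N.
Proof.
by elim: t => // t IH; rewrite wordsS size_allpairs size_iota IH expnS.
Qed.

Section Mixing.
Variables (R : realFieldType) (r : nat).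
Notation vertex := {ffun 'I_r.+1 -> bool * bool}.

(* The letters above 3 act trivially: half of the steps of the walk are lazy,
   so that no eigenvalue is close to -1. *)
Definition letter (l : nat) : vertex -> vertex :=
  match l with
  | 0 => @swapv r | 1 => @addv r | 2 => @shiftv r | 3 => @flipv r | _ => id
  end.

Definition act (w : seq nat) (v : vertex) : vertex := foldr letter v w.

Lemma letterK l : involutive (letter l).
Proof.
case: l => [|[|[|[|l]]]] //; [exact: swapvK|exact: addvK|exact: shiftvK|].
exact: flipvK.
Qed.

Lemma act_inj w : injective (act w).
Proof.
by elim: w => // l w IH u v /= /(inv_inj (letterK l)) /IH.
Qed.

Lemma sum_inj_comp (h : vertex -> vertex) (F : vertex -> R) :
  injective h -> \sum_v F (h v) = \sum_v F v.
Proof. by move=> hI; rewrite [RHS](reindex_inj hI). Qed.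

Lemma card_vertex : #|{: vertex}| = (4 ^ r.+1)%N.
Proof. by rewrite card_ffun card_prod card_bool card_ord. Qed.

Definition walk_step (f : vertex -> R) (v : vertex) : R :=
  \sum_(l <- iota 0 8) f (letter l v).

(** The loss is [1 / (16 * 152)]: Cauchy-Schwarz over four pairs gives
    [4 * (16 - 1/152) = 64 * gap]. *)
Definition gap : R := 1 - 1/2432.

Lemma walk_stepE f v : walk_step f v =
  (f v + f (swapv v)) + (f v + f (addv v)) + (f v + f (shiftv v))
  + (f v + f (flipv v)).
Proof. by rewrite /walk_step !big_cons big_nil /=; ring. Qed.

Lemma sum_walk_step f : \sum_v walk_step f v = 8 * \sum_v f v.
Proof.
rewrite /walk_step exchange_big /= (eq_bigr (fun=> \sum_v f v)).
  by rewrite !big_cons big_nil; ring.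
by move=> l _; apply/sum_inj_comp/inv_inj/letterK.
Qed.

Lemma energy_sum (f : vertex -> R) g : involutive g ->
  \sum_v (f v + f (g v)) ^+ 2 = 4 * (\sum_v f v ^+ 2) - energy f g :> R.
Proof.
move=> gK; apply/eqP; rewrite eq_sym subr_eq -big_split /=; apply/eqP.
have -> : 4 * (\sum_v f v ^+ 2) =
    2 * (\sum_v f v ^+ 2) + 2 * \sum_v f (g v) ^+ 2.
  by rewrite (sum_inj_comp (fun v => f v ^+ 2) (inv_inj gK)); ring.
by rewrite !mulr_sumr -big_split; apply: eq_bigr => v _ /=; ring.
Qed.

(** The lazy letters pair each generator [g] with the identity, and by the parallelogram law the
    norm of [f + f \o g] is [4 |f|^2] minus an energy; [poincare] bounds the sum of the four
    energies from below. *)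
Lemma walk_step_contract f : \sum_v f v = 0 ->
  \sum_v walk_step f v ^+ 2 <= 64 * gap * \sum_v f v ^+ 2.
Proof.
move=> /poincare P.
pose G g := \sum_v (f v + f (g v)) ^+ 2.
have : \sum_v walk_step f v ^+ 2 <=
    4 * (G (@swapv r) + G (@addv r) + G (@shiftv r) + G (@flipv r)).
  rewrite /G -!big_split /= mulr_sumr; apply: ler_sum => v _.
  rewrite walk_stepE; set a := f v + f (swapv v); set b := f v + f (addv v).
  set c := f v + f (shiftv v); set d := f v + f (flipv v).
  have := sqr_ge0 (a - b); have := sqr_ge0 (a - c); have := sqr_ge0 (a - d).
  have := sqr_ge0 (b - c); have := sqr_ge0 (b - d); have := sqr_ge0 (c - d).
  by nra.
rewrite /G (energy_sum _ (@swapvK r)) (energy_sum _ (@addvK r)).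
rewrite (energy_sum _ (@shiftvK r)) (energy_sum _ (@flipvK r)) /gap.
by move: P; lra.
Qed.

Definition walk t f v : R := \sum_(w <- words t) f (act w v).

Lemma walkS t f v : walk t.+1 f v = walk t (walk_step f) v.
Proof.
rewrite /walk wordsS big_allpairs_dep exchange_big /=.
by apply: eq_bigr.
Qed.

Lemma walk_contract t f : \sum_v f v = 0 ->
  \sum_v walk t f v ^+ 2 <= (64 * gap) ^+ t * \sum_v f v ^+ 2.
Proof.
elim: t f => [|t IH] f f0.
  rewrite expr0 mul1r; apply: ler_sum => v _.
  by rewrite /walk /= big_seq1.
under eq_bigr => v _ do rewrite walkS.
apply: le_trans (IH _ _) _; first by rewrite sum_walk_step f0 mulr0.
rewrite exprSr -[leRHS]mulrA; apply: ler_wpM2l; last exact: walk_step_contract.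
by apply: exprn_ge0; rewrite /gap; lra.
Qed.

(** The expander mixing lemma, with the arithmetic mean of the two sizes in place of the geometric
    one to avoid roots. For the same reason words have even length: the contraction factor
    [(64 * gap) ^+ t.*2] is then a square. *)
Lemma walk_mixing t (X Y : {set vertex}) :
  \sum_(v in X) walk t.*2 (fun u => (u \in Y)%:R) v <=
  (8 ^ t.*2)%:R * (#|X|%:R * #|Y|%:R / (4 ^ r.+1)%:R
    + gap ^+ t * (#|X|%:R + #|Y|%:R) / 2).
Proof.
set N : R := (4 ^ r.+1)%:R; set d : R := (8 ^ t.*2)%:R.
have N0 : 0 < N by rewrite ltr0n expn_gt0.
have d0 : 0 < d by rewrite ltr0n expn_gt0.
pose p : R := #|Y|%:R / N.
pose f (u : vertex) : R := (u \in Y)%:R - p.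
have sY : \sum_(u : vertex) (u \in Y)%:R = #|Y|%:R :> R.
  by rewrite -sum1_card natr_sum [RHS]big_mkcond; apply: eq_bigr => u _; case: ifP.
have sp : \sum_(u : vertex) p = #|Y|%:R.
  by rewrite sumr_const card_vertex -[LHS]mulr_natr divfK // gt_eqF.
have f0 : \sum_u f u = 0 by rewrite sumrB sY sp subrr.
have f2 : \sum_u f u ^+ 2 <= #|Y|%:R.
  rewrite -sY -subr_ge0 -sumrB.
  rewrite (eq_bigr (fun u => 2 * p * f u + p ^+ 2)).
    by rewrite big_split /= -mulr_sumr f0 mulr0 add0r sumr_ge0 // => u _; rewrite sqr_ge0.
  by move=> u _; rewrite /f; case: (u \in Y) => /=; ring.
have wE v : walk t.*2 (fun u => (u \in Y)%:R) v = walk t.*2 f v + d * p.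
  rewrite /walk /f sumrB big_const_seq count_predT size_words iter_addr_0.
  by rewrite /d [p *+ _](esym (mulr_natl _ _)) subrK.
have := walk_contract t.*2 f0.
have -> : (64 * gap) ^+ t.*2 = d ^+ 2 * (gap ^+ t) ^+ 2.
  have -> : 64 = 8 ^+ 2 :> R by ring.
  by rewrite exprMn /d natrX -!exprM (mulnC 2) -(muln2 t).
move=> wf; under eq_bigr => v _ do rewrite wE.
rewrite big_split /= sumr_const -[_ *+ #|X|]mulr_natl.
set k := d * gap ^+ t.
have gt0 : 0 < gap ^+ t by rewrite exprn_gt0 // /gap; lra.
have k0 : 0 < k by rewrite mulr_gt0.
have w2 : \sum_(v in X) walk t.*2 f v ^+ 2 <= k ^+ 2 * #|Y|%:R.
  apply: le_trans (_ : \sum_v walk t.*2 f v ^+ 2 <= _).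
    by rewrite [leRHS](bigID (mem X)) /= lerDl sumr_ge0 // => v _; rewrite sqr_ge0.
  apply: le_trans wf _; rewrite /k exprMn; apply: ler_wpM2l f2.
  by rewrite mulr_ge0 // sqr_ge0.
have h : 2 * k * \sum_(v in X) walk t.*2 f v <=
    k ^+ 2 * #|X|%:R + \sum_(v in X) walk t.*2 f v ^+ 2.
  rewrite mulr_natr -sumr_const mulr_sumr -big_split /=.
  apply: ler_sum => v _; have := sqr_ge0 (k - walk t.*2 f v).
  by nra.
have : \sum_(v in X) walk t.*2 f v <= k * (#|X|%:R + #|Y|%:R) / 2.
  rewrite -(ler_pM2l k0) -(ler_pM2l (ltr0n R 2)) /=; move: h w2; set s := \sum_(v in X) _.
  set s2 := \sum_(v in X) _; lra.
rewrite /k /p; lra.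
Qed.

End Mixing.

(** * Orientation of sparse edge sets *)

Section Orientation.
Variables (E V1 V2 : finType) (lft : E -> V1) (rgt : E -> V2).

Lemma card_fibers (V : finType) (h : E -> V) (S : {set E}) (k : nat) :
  (forall v, v \in h @: S -> k < #|[set e in S | h e == v]|)%N ->
  (k.+1 * #|h @: S| <= #|S|)%N.
Proof.
move=> hk; rewrite -[leqRHS]sum1_card (partition_big_imset h) /=.
rewrite mulnC -sum_nat_const; apply: leq_sum => v vS.
by rewrite sum1dep_card; apply: leq_trans (hk v vS) _; rewrite cardsE.
Qed.

(* Every vertex of small degree can take all of its remaining edges; removing
   it and iterating distributes all edges. *)
Lemma orientation (k : nat) (S : {set E}) :
  (forall S' : {set E}, S' \subset S ->
     2 * #|S'| <= k * (#|lft @: S'| + #|rgt @: S'|))%N ->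
  exists L : {set E}, [/\ L \subset S,
    forall v, (#|[set e in L | lft e == v]| <= k)%N &
    forall u, (#|[set e in S :\: L | rgt e == u]| <= k)%N].
Proof.
have [m] := ubnP #|S|; elim: m S => // m IH S ltm sp.
have [->|/set0Pn[e0 e0S]] := eqVneq S set0.
  by exists set0; split=> [|v|u]; rewrite ?sub0set // ?set0D;
    rewrite (_ : [set _ in _ | _] = set0) ?cards0 //; apply/setP => e;
    rewrite !inE.
have IHD (U : {set E}) e : e \in S -> e \in U ->
    exists L : {set E}, [/\ L \subset S :\: U,
    forall v, (#|[set e in L | lft e == v]| <= k)%N &
    forall u, (#|[set e in (S :\: U) :\: L | rgt e == u]| <= k)%N].
  move=> eS eU; apply: IH => [|S' sS'].
    rewrite -ltnS; apply: leq_trans ltm; rewrite ltnS; apply: proper_card.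
    by apply/properP; split; [exact: subsetDl|exists e; rewrite // !inE eU].
  by apply: sp; apply: subset_trans sS' (subsetDl _ _).
case: (boolP [exists v, (v \in lft @: S) &&
                        (#|[set e in S | lft e == v]| <= k)%N]).
  move=> /existsP[v /andP[/imsetP[e eS ev] dv]].
  have [|L [LS Ll Lr]] := IHD [set e | lft e == v] e eS; first by rewrite inE ev.
  exists (L :|: [set e in S | lft e == v]); split.
  - apply/subsetP => x; rewrite !inE => /orP[/(subsetP LS)|/andP[]//].
    by rewrite !inE => /andP[].
  - move=> v'; have [->|ne] := eqVneq v' v.
      apply: leq_trans dv; apply/subset_leq_card/subsetP => x; rewrite !inE.
      by move=> /andP[/orP[/(subsetP LS)|/andP[->]//]] + /eqP ->;
        rewrite !inE => /andP[_ ->]; rewrite eqxx.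
    apply: leq_trans (Ll v'); apply/subset_leq_card/subsetP => x; rewrite !inE.
    by move=> /andP[/orP[->|/andP[_ /eqP ->]]] //; rewrite eq_sym (negbTE ne).
  - move=> u; apply: leq_trans (Lr u); apply/subset_leq_card/subsetP => x.
    rewrite !inE => /andP[/andP[nx xS] ->]; move: nx; rewrite xS !andbT /=.
    by rewrite negb_or.
rewrite negb_exists => /forallP nl.
case: (boolP [exists u, (u \in rgt @: S) &&
                        (#|[set e in S | rgt e == u]| <= k)%N]).
  move=> /existsP[u /andP[/imsetP[e eS eu] du]].
  have [|L [LS Ll Lr]] := IHD [set e | rgt e == u] e eS; first by rewrite inE eu.
  exists L; split=> [|//|u'].
    by apply: subset_trans LS (subsetDl _ _).
  have [->|ne] := eqVneq u' u.
    apply: leq_trans du; apply/subset_leq_card/subsetP => x; rewrite !inE.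
    by move=> /andP[/andP[_ ->]].
  apply: leq_trans (Lr u'); apply/subset_leq_card/subsetP => x; rewrite !inE.
  by move=> /andP[/andP[-> ->] /eqP ->]; rewrite ne eqxx.
(* Now every vertex met by [S] has degree at least [k + 1]. Counting [S] from both sides gives
   [k + 1] times the number of these vertices as a lower bound for [2 * #|S|], against the
   hypothesis for [S] itself. *)
rewrite negb_exists => /forallP nr.
have hl : (k.+1 * #|lft @: S| <= #|S|)%N.
  by apply: card_fibers => v vS; move: (nl v); rewrite vS /= -ltnNge.
have hr : (k.+1 * #|rgt @: S| <= #|S|)%N.
  by apply: card_fibers => v vS; move: (nr v); rewrite vS /= -ltnNge.
have l0 : (0 < #|lft @: S|)%N.
  by apply/card_gt0P; exists (lft e0); apply: imset_f.
by have := sp S (subxx _); lia.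
Qed.

End Orientation.

Lemma sum_pair (R : nmodType) (I J : finType) (F : I * J -> R) :
  \sum_e F e = \sum_i \sum_j F (i, j).
Proof. by rewrite pair_bigA; apply: eq_bigr => -[]. Qed.

(** * From the local to the global null space property *)

Section GlobalNSP.
Variables (R : realFieldType) (V : finType) (d ml : nat).
Variables (pi : 'I_d -> V -> V) (pi_inj : forall w, injective (pi w)).

(** For a kernel vector this limits the share of the l1 mass on any [k] coordinates to [th]; the
    [tau] term makes the property robust. *)
Definition local_nsp (B : 'I_ml -> 'I_d -> bool) (k : nat) (th tau : R) :=
  forall (x : 'I_d -> R) (T : {set 'I_d}), (#|T| <= k)%N ->
  \sum_(w in T) `|x w| <=
    th * (\sum_w `|x w|) + tau * \sum_i `|\sum_w (B i w)%:R * x w|.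

Let edge : finType := (V * 'I_d)%type.
Let rgt (e : edge) := pi e.2 e.1.

(** The edges in [L] are bounded at their left ends, those of [S :\: L] at their right ends. A sum
    over one side sees each edge once, so the two sides give [2 * th]. *)
Lemma tanner_nsp (B : 'I_ml -> 'I_d -> bool) (k : nat) (th tau : R)
    (S : {set edge}) (x : edge -> R) :
  local_nsp B k th tau ->
  (forall S' : {set edge}, S' \subset S ->
     2 * #|S'| <= k * (#|fst @: S'| + #|rgt @: S'|))%N ->
  \sum_(e in S) `|x e| <= 2 * th * (\sum_e `|x e|) +
    tau * (\sum_v \sum_i `|\sum_w (B i w)%:R * x (v, w)| +
           \sum_u \sum_i `|\sum_(e | rgt e == u) (B i e.2)%:R * x e|).
Proof.
move=> nsp sp; have [L [LS Ll Lr]] := orientation sp.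
(* Each [pi w] is a bijection, so the edges at a right vertex are indexed by the words too, and the
   local inequality applies there. *)
pose inv w := invF (@pi_inj w).
have sum_inv (F : edge -> R) : \sum_e F e = \sum_u \sum_w F (inv w u, w).
  rewrite sum_pair exchange_big [RHS]exchange_big /=; apply: eq_bigr => w _.
  rewrite [RHS](reindex_inj (@pi_inj w)) /=; apply: eq_bigr => v _.
  by rewrite /inv invF_f.
have left_part : \sum_(e in L) `|x e| <= th * (\sum_e `|x e|) +
    tau * \sum_v \sum_i `|\sum_w (B i w)%:R * x (v, w)|.
  rewrite big_mkcond !sum_pair.
  rewrite !mulr_sumr -big_split /=; apply: ler_sum => v _.
  rewrite -big_mkcond /=.
  rewrite (eq_bigl (mem [set w | (v, w) \in L])); last first.
    by move=> w; rewrite !inE.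
  apply: (nsp (fun w => x (v, w))); apply: leq_trans (Ll v).
  rewrite -(card_imset _ (_ : injective (fun w => (v, w)))); last by move=> ? ? [].
  apply/subset_leq_card/subsetP => e /imsetP[w]; rewrite inE => wL ->.
  by rewrite inE wL eqxx.
have right_part : \sum_(e in S :\: L) `|x e| <= th * (\sum_e `|x e|) +
    tau * \sum_u \sum_i `|\sum_(e | rgt e == u) (B i e.2)%:R * x e|.
  have rowE u i : \sum_(e | rgt e == u) (B i e.2)%:R * x e =
      \sum_w (B i w)%:R * x (inv w u, w).
    rewrite big_mkcond sum_inv /= (bigD1 u) //= [X in _ + X]big1 ?addr0.
      by apply: eq_bigr => w _; rewrite /rgt /= f_invF eqxx.
    move=> v /negbTE ne; apply: big1 => w _.
    by rewrite /rgt /= f_invF ne.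
  under [X in tau * X]eq_bigr => u _ do under eq_bigr => i _ do rewrite rowE.
  rewrite big_mkcond !sum_inv !mulr_sumr -big_split /=; apply: ler_sum => u _.
  rewrite -big_mkcond /=.
  rewrite (eq_bigl (mem [set w | (inv w u, w) \in S :\: L])); last first.
    by move=> w; rewrite !inE.
  apply: (nsp (fun w => x (inv w u, w))); apply: leq_trans (Lr u).
  rewrite -(card_imset _ (_ : injective (fun w => (inv w u, w)))); last by move=> ? ? [].
  apply/subset_leq_card/subsetP => e /imsetP[w]; rewrite inE => wL ->.
  by rewrite inE wL /= /rgt /= f_invF eqxx.
have -> : \sum_(e in S) `|x e| = \sum_(e in L) `|x e| + \sum_(e in S :\: L) `|x e|.
  rewrite (bigID (mem L)) /=; congr (_ + _); apply: eq_bigl => e.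
    by case: (boolP (e \in L)) => [/(subsetP LS) ->|_]; rewrite ?andbF.
  by rewrite inE andbC.
lra.
Qed.

End GlobalNSP.

(** * Sparse edge sets of the walk graph have vertices of small degree *)

Section ExpanderOrientation.
Variables (R : realFieldType) (r t : nat).
Notation vertex := {ffun 'I_r.+1 -> bool * bool}.
Let d := (8 ^ t.*2)%N.

Definition word_act (w : 'I_d) : vertex -> vertex :=
  act (nth [::] (words t.*2) w).

Lemma word_act_inj w : injective (word_act w).
Proof. exact: act_inj. Qed.

(** Let [p] be the number of vertices met by [S]. If [k p >= 2 delta N d], the sparsity of [S]
    suffices. Otherwise [p] is so small that the main term [d |X| |Y| / N] of the mixing bound is at
    most [k p / 4]; this uses [k^2 >= 2 delta d^2]. The lower bound on [k] by [gap ^+ t] handles the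
    error term. *)
Lemma expander_sparse (k : nat) (delta : R) (S : {set vertex * 'I_d}) :
  (0 < k)%N -> 2 * delta * d%:R ^+ 2 <= k%:R ^+ 2 ->
  gap R ^+ t * 2 * d%:R <= k%:R ->
  #|S|%:R <= delta * (4 ^ r.+1 * d)%:R ->
  (2 * #|S| <= k * (#|fst @: S| + #|(fun e => word_act e.2 e.1) @: S|))%N.
Proof.
move=> k0 kd gk Sd.
set X := fst @: S; set Y := _ @: S.
set N : R := (4 ^ r.+1)%:R; set D : R := d%:R; set K : R := k%:R.
have N0 : 0 < N by rewrite ltr0n expn_gt0.
have D0 : 0 < D by rewrite ltr0n expn_gt0.
have K0 : 0 < K by rewrite ltr0n.
have SE : #|S|%:R <= \sum_(v in X) walk t.*2 (fun u => (u \in Y)%:R) v :> R.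
  have -> : \sum_(v in X) walk t.*2 (fun u => (u \in Y)%:R) v =
     \sum_(v in X) \sum_(w < d) (word_act w v \in Y)%:R :> R.
    apply: eq_bigr => v _; rewrite /walk (big_nth [::]) size_words big_mkord.
    by apply: eq_bigr.
  rewrite -sum1_card natr_sum (partition_big fst (mem X)) /=; last first.
    by move=> e eS; apply: imset_f.
  apply: ler_sum => v vX.
  rewrite big_mkcond sum_pair /=.
  rewrite (bigD1 v) //= [X in _ + X]big1 ?addr0; last first.
    by move=> v' /negbTE ne; apply: big1 => w _; rewrite ne andbF.
  apply: ler_sum => w _; rewrite eqxx andbT.
  case: ifP => [vw|_]; last exact: ler0n.
  by rewrite (_ : word_act w v \in Y) //; apply/imsetP; exists (v, w).
set p : R := #|X|%:R + #|Y|%:R.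
have p0 : 0 <= p by rewrite addr_ge0.
suff : 2 * #|S|%:R <= K * p.
  by rewrite /K /p -natrD -!natrM ler_nat.
move: Sd; rewrite natrM -/N -/D => Sd.
have [big|small] := lerP (2 * delta * N * D) (K * p); first by lra.
apply: le_trans (_ : 2 * (D * (#|X|%:R * #|Y|%:R / N + gap R ^+ t * p / 2)) <= _).
  rewrite ler_pM2l ?ltr0n //; apply: le_trans SE _; exact: walk_mixing.
have xy : #|X|%:R * #|Y|%:R <= p ^+ 2 / 4.
  by rewrite /p; have := sqr_ge0 (#|X|%:R - #|Y|%:R : R); nra.
have step1 : 2 * (D * (#|X|%:R * #|Y|%:R / N)) <= K * p / 2.
  rewrite -(ler_pM2l K0) -(ler_pM2l N0).
  have -> : N * (K * (2 * (D * (#|X|%:R * #|Y|%:R / N)))) =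
     2 * K * D * (#|X|%:R * #|Y|%:R) by field; rewrite gt_eqF.
  apply: le_trans (_ : 2 * K * D * (p ^+ 2 / 4) <= _).
    by rewrite ler_wpM2l // !mulr_ge0 // ltW.
  have e1 : D * (K * p) * p <= D * (2 * delta * N * D) * p.
    by rewrite ler_wpM2r // ler_wpM2l ?ltW.
  have e2 : (2 * delta * D ^+ 2) * (N * p) <= K ^+ 2 * (N * p).
    by rewrite ler_wpM2r // mulr_ge0 // ltW.
  have := e1; have := e2; nra.
have step2 : gap R ^+ t * 2 * D * p <= K * p by rewrite ler_wpM2r.
nra.
Qed.

End ExpanderOrientation.

(** * The null space property of lossless expanders *)

Section LosslessExpander.
Variables (d ml D : nat) (nb : 'I_d -> {set 'I_ml}).
Hypothesis card_nb : forall w, #|nb w| = D.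
Definition nbs (W : {set 'I_d}) : {set 'I_ml} := \bigcup_(w in W) nb w.

Definition expanding (K : nat) := forall W : {set 'I_d}, (#|W| <= K)%N ->
  (31 * D * #|W| <= 32 * #|nbs W|)%N.

Let uniq_nb (U : {set 'I_d}) w := nb w :\: nbs (U :\ w).

(** Double counting by rows: a row met once is counted in [nb] and in [uniq_nb], any other row of
    [nbs U] at least twice in [nb]. *)
Lemma sum_uniq_nb (U : {set 'I_d}) :
  (2 * #|nbs U| <= D * #|U| + \sum_(w in U) #|uniq_nb U w|)%N.
Proof.
have dc (F : 'I_d -> {set 'I_ml}) :
    (\sum_(w in U) #|F w| = \sum_i \sum_(w in U) (i \in F w))%N.
  rewrite exchange_big /=; apply: eq_bigr => w _.
  by rewrite -sum1_card big_mkcond /=; apply: eq_bigr => i _; case: (i \in F w).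
have -> : (D * #|U| = \sum_(w in U) #|nb w|)%N.
  by rewrite mulnC -sum_nat_const; apply: eq_bigr => w _; rewrite card_nb.
rewrite !dc -big_split /= -sum1_card big_mkcond big_distrr /=.
apply: leq_sum => i _; case: ifP => // /bigcupP[w wU iw].
have [iu|niu] := boolP (i \in uniq_nb U w).
  by rewrite (bigD1 w) //= iw [X in (_ + X)%N](bigD1 w) //= iu; lia.
move: niu; rewrite inE iw andbT negbK => /bigcupP[w' /setD1P[ne w'U] iw'].
by rewrite (bigD1 w) //= (bigD1 w') /= ?w'U // iw iw'; lia.
Qed.

(** By [sum_uniq_nb] the average number of private neighbours is at least
    [(2 * 31/32 - 1) D = 15/16 D]. *)
Lemma exists_uniq_nb K (U : {set 'I_d}) : expanding K -> (#|U| <= K)%N ->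
  U != set0 -> exists2 w, w \in U & (15 * D <= 16 * #|uniq_nb U w|)%N.
Proof.
move=> ex UK U0; case: (boolP [exists w in U, (15 * D <= 16 * #|uniq_nb U w|)%N]).
  by move=> /exists_inP[w wU h]; exists w.
rewrite negb_exists => /forallP h.
have := sum_uniq_nb U; have := ex U UK.
have : (\sum_(w in U) (16 * #|uniq_nb U w|).+1 <= \sum_(w in U) 15 * D)%N.
  by apply: leq_sum => w wU; move: (h w); rewrite wU /= -ltnNge.
rewrite sum_nat_const.
have -> : (\sum_(w in U) (16 * #|uniq_nb U w|).+1 =
   16 * (\sum_(w in U) #|uniq_nb U w|) + #|U|)%N.
  rewrite big_distrr -[in RHS]sum1_card -big_split /=.
  by apply: eq_bigr => w _; rewrite addn1.
have : (0 < #|U|)%N by rewrite card_gt0.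
by nia.
Qed.

(* Peeling off vertices with many private neighbours gives most of the
   neighbours of each vertex of U a single owner. *)
Lemma owners K (U : {set 'I_d}) : expanding K -> (#|U| <= K)%N ->
  exists fo : 'I_ml -> option 'I_d,
    (forall i w, fo i = Some w -> w \in U /\ i \in nb w) /\
    (forall w, w \in U -> (15 * D <= 16 * #|[set i | fo i == Some w]|)%N).
Proof.
move=> ex; have [m] := ubnP #|U|; elim: m U => // m IH U ltm UK.
have [->|U0] := eqVneq U set0.
  by exists (fun=> None); split => // w; rewrite inE.
have [w wU hw] := exists_uniq_nb ex UK U0.
have cU : #|U| = #|U :\ w|.+1 by rewrite (cardsD1 w U) wU.
have [||fo [hw1 hw2]] := IH (U :\ w); first by rewrite cU in ltm.
  by rewrite cU in UK; apply: ltnW.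
exists (fun i => if i \in uniq_nb U w then Some w else fo i); split=> [i w'|w' w'U].
  case: ifP => [iu [<-]|_ /hw1[]]; first by split=> //; case/setDP: iu.
  by move=> /setD1P[].
have [->|ne] := eqVneq w' w.
  apply: leq_trans hw _; rewrite leq_mul2l; apply/orP; right.
  by apply/subset_leq_card/subsetP => i iu; rewrite inE iu.
apply: leq_trans (hw2 w' _) _; first by rewrite !inE ne.
rewrite leq_mul2l; apply/orP; right.
apply/subset_leq_card/subsetP => i; rewrite !inE => /eqP oi.
have [w'D iw'] := hw1 _ _ oi.
suff -> : i \in nbs (U :\ w) by rewrite /= oi.
by apply/bigcupP; exists w'.
Qed.

(** [U] minimizes [16 |nbs U| - 15 D |U|] (shifted by a constant to stay in [nat]) among small
    supersets of [T]. Adding an outside [w] does not lower it, so at least [15/16 D] neighbours of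
    [w] are new. One more element is always allowed: comparing [U] with [T], expansion gives
    [D |U| / 2 <= D |T|], so [|U| <= 2 k]. *)
Lemma expander_closure k (T : {set 'I_d}) : (0 < D)%N ->
  expanding (2 * k).+1 -> (#|T| <= k)%N ->
  exists U : {set 'I_d}, [/\ T \subset U, (#|U| <= (2 * k).+1)%N &
    forall w, w \notin U -> (16 * #|nb w :&: nbs U| <= D)%N].
Proof.
move=> D0 ex Tk.
pose P (U : {set 'I_d}) := (T \subset U) && (#|U| <= (2 * k).+1)%N.
pose F (U : {set 'I_d}) := (16 * #|nbs U| + 15 * D * (d - #|U|))%N.
have PT : P T by rewrite /P subxx; lia.
case: (arg_minnP F PT) => U /andP[TU UK] minU; exists U; split=> // w wU.
have cd (W : {set 'I_d}) : (#|W| <= d)%N by rewrite -[leqRHS]card_ord max_card.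
have nT : (#|nbs T| <= D * #|T|)%N.
  rewrite mulnC -sum_nat_const /nbs.
  apply: (@big_ind2 {set 'I_ml} nat (fun A m => #|A| <= m)%N) => [|A a B b Aa Bb|u _].
  - by rewrite cards0.
  - by rewrite (leq_trans (leq_card_setU _ _)) // leq_add.
  - by rewrite card_nb.
have U2 : (#|U| <= 2 * k)%N.
  have := minU T PT; have := ex U UK; have := cd U; have := cd T.
  rewrite /F; nia.
have PU : P (w |: U).
  by rewrite /P (subset_trans TU (subsetUr _ _)) cardsU1 wU; lia.
have := minU _ PU; rewrite /F cardsU1 wU /=.
have -> : nbs (w |: U) = nb w :|: nbs U by rewrite /nbs bigcup_setU big_set1.
have := cardsUI (nb w) (nbs U); rewrite card_nb.
have := cd (w |: U); rewrite cardsU1 wU /=; nia.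
Qed.

(** A row owned by [w] bounds [|x w|] minus the other entries of that row. Summed over the owned
    rows, a column of [U] gets coefficient at least [15/16 D - 1/16 D], and a column outside at
    least [- 1/16 D], since owned rows lie in [nbs U]. Adding [1/16 D] times the mass on [U] to both
    sides leaves [15/16 D] in front, whence [1/15] and [16 / (15 D)]. *)
Lemma expander_nsp (R : realFieldType) k : (0 < D)%N ->
  expanding (2 * k).+1 ->
  local_nsp (fun i w => i \in nb w) k (1 / 15 : R) (16 / (15 * D%:R)).
Proof.
move=> D0 ex x T Tk.
have [U [TU UK out]] := expander_closure D0 ex Tk.
have [fo [hw1 hw2]] := owners ex UK.
pose c i w : R := if fo i is Some w' then (if w == w' then 1 else - (i \in nb w)%:R) else 0.
have row i : \sum_w c i w * `|x w| <= `|\sum_w (i \in nb w)%:R * x w|.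
  rewrite /c; case oi: (fo i) => [w|]; last by rewrite big1 // => w _; rewrite mul0r.
  have [wU iw] := hw1 _ _ oi.
  rewrite (bigD1 w) //= eqxx mul1r [X in _ <= `|X|](bigD1 w) //= iw mul1r.
  apply: le_trans (_ : `|x w| - `|\sum_(j | j != w) (i \in nb j)%:R * x j| <= _).
    rewrite lerD2l lerNr -sumrN; apply: le_trans (ler_norm_sum _ _ _) _.
    apply: ler_sum => j /negbTE ->; rewrite normrM mulNr opprK.
    by rewrite ger0_norm // ler0n.
  set s := \sum_(_ | _) _.
  by have := ler_normB (x w + s) s; rewrite addrK; lra.
have colU w : w \in U -> 7 / 8 * D%:R <= \sum_i c i w.
  move=> wU; pose O := [set i | fo i == Some w].
  have ON : O \subset nb w.
    by apply/subsetP => i; rewrite inE => /eqP /hw1[].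
  apply: le_trans (_ : \sum_i ((i \in O)%:R - (i \in nb w :\: O)%:R) <= _).
    rewrite sumrB -!natr_sum.
    have sumE (A : {set 'I_ml}) : (\sum_i (i \in A) = #|A|)%N.
      by rewrite -sum1_card [RHS]big_mkcond; apply: eq_bigr => i _; case: (i \in A).
    rewrite !sumE cardsD (setIidPr ON) card_nb.
    have h : (#|O| <= D)%N by rewrite -(card_nb w) subset_leq_card.
    rewrite natrB //; move: (hw2 w wU); rewrite -/O -(ler_nat R) !natrM.
    by lra.
  apply: ler_sum => i _; rewrite /c /O !inE; case: (fo i) => [w'|] /=.
    rewrite (inj_eq (@Some_inj _)) [w' == w]eq_sym; case: eqP => _ /=.
      by lra.
    by rewrite sub0r.
  by rewrite sub0r oppr_le0 ler0n.
have colN w : w \notin U -> - (1 / 16 * D%:R) <= \sum_i c i w.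
  move=> wU; apply: le_trans (_ : - (#|nb w :&: nbs U|)%:R <= _).
    by rewrite lerN2; move: (out w wU); rewrite -(ler_nat R) natrM; lra.
  rewrite -sum1_card natr_sum big_mkcond -sumrN; apply: ler_sum => i _.
  rewrite /c; case oi: (fo i) => [w'|]; last by case: ifP; rewrite ?oppr0 // oppr_le0.
  have [w'U iw'] := hw1 _ _ oi; case: eqP => [e|_].
    by rewrite e w'U in wU.
  have -> : (i \in nb w :&: nbs U) = (i \in nb w).
    by rewrite inE (_ : i \in nbs U) ?andbT //; apply/bigcupP; exists w'.
  by case: (i \in nb w).
have main : 7 / 8 * D%:R * (\sum_(w in U) `|x w|)
   - 1 / 16 * D%:R * (\sum_(w | w \notin U) `|x w|) <=
   \sum_i `|\sum_w (i \in nb w)%:R * x w|.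
  apply: le_trans (_ : \sum_i \sum_w c i w * `|x w| <= _); last first.
    by apply: ler_sum.
  rewrite exchange_big /= [leRHS](bigID (mem U)) /= !mulr_sumr -sumrN.
  apply: lerD; apply: ler_sum => w wU; rewrite -mulr_suml.
    by rewrite ler_wpM2r // colU.
  by rewrite -mulNr ler_wpM2r // colN.
have TUx : \sum_(w in T) `|x w| <= \sum_(w in U) `|x w|.
  rewrite [leRHS](bigID (mem T)) /= [X in _ <= X + _](eq_bigl (mem T)) => [|w].
    by rewrite lerDl sumr_ge0.
  by apply/andP/idP => [[]//|wT]; split=> //; apply: (subsetP TU).
apply: le_trans TUx _.
rewrite [X in 1 / 15 * X](bigID (mem U)) /=.
have DR : 0 < D%:R :> R by rewrite ltr0n.
move: main; set a := \sum_(w in U) _; set b := \sum_(w | _) _; set s := \sum_i _.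
move=> main; rewrite -(ler_pM2l DR).
have -> : D%:R * (1 / 15 * (a + b) + 16 / (15 * D%:R) * s) =
  1/15 * (D%:R * a) + 1/15 * (D%:R * b) + 16/15 * s by field; rewrite gt_eqF.
by move: main; lra.
Qed.

End LosslessExpander.

(** * Existence of lossless expanders *)

Section RandomExpander.
Variable R : realType.

(** A weak Stirling bound; the induction step is [(1 + 1/b)^b <= e]. *)
Lemma expn_le_fact (b : nat) : b%:R ^+ b <= expR 1 ^+ b * b`!%:R :> R.
Proof.
elim: b => [|b IH]; first by rewrite !expr0 mul1r.
have [->|b0] := posnP b.
  by rewrite !expr1 mulr1 -[1%:R]expR0 ler_expR.
have bR : 0 < b%:R :> R by rewrite ltr0n.
rewrite factS natrM exprS mulrCA ler_wpM2l ?ler0n //.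
have -> : b.+1%:R = b%:R * (1 + b%:R^-1) :> R.
  by rewrite mulrDr mulr1 mulfV ?gt_eqF // natr1.
rewrite exprMn exprSr -mulrA [expR 1 * _]mulrC mulrA; apply: ler_pM;
  rewrite ?exprn_ge0 ?addr_ge0 ?invr_ge0 ?ler0n //.
have -> : expR 1 = expR b%:R^-1 ^+ b :> R.
  by rewrite -expRM_natl mulfV // gt_eqF.
by rewrite lerXn2r ?nnegrE ?expR_ge0 ?addr_ge0 ?invr_ge0 ?ler0n // expR_ge1Dx.
Qed.

Lemma bin_bound (n b : nat) :
  'C(n, b)%:R * b%:R ^+ b <= expR 1 ^+ b * n%:R ^+ b :> R.
Proof.
have f0 : 0 < b`!%:R :> R by rewrite ltr0n fact_gt0.
rewrite -(ler_pM2r f0) mulrAC -natrM bin_ffact.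
apply: le_trans (_ : n%:R ^+ b * b%:R ^+ b <= _).
  rewrite ler_wpM2r ?exprn_ge0 ?ler0n // -natrX ler_nat.
  rewrite ffact_prod -[X in (_ <= _ ^ X)%N](card_ord b) -prod_nat_const.
  by apply: leq_prod => i _; apply: leq_subr.
by rewrite mulrC [expR 1 ^+ b * _ * _]mulrAC ler_wpM2r ?exprn_ge0 ?ler0n // expn_le_fact.
Qed.

Variables (d D M : nat).
Notation code := {ffun 'I_d * 'I_D -> 'I_M}.
Notation row := ('I_D * 'I_M)%type.

(** The rows form [D] blocks of size [M] and a column takes one row in each block, so it has exactly
    [D] ones for every code. *)
Definition code_nb (f : code) (w : 'I_d) : {set row} :=
  [set (s, f (w, s)) | s : 'I_D].

Lemma card_code_nb f w : #|code_nb f w| = D.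
Proof. by rewrite card_imset ?card_ord // => s s' []. Qed.

(** The choices are independent, so each column of [W] contributes the product over the blocks of
    the densities of [Y]; the mean inequality bounds it by the overall density to the power [D]. *)
Lemma card_confined (W : {set 'I_d}) (Y : {set row}) : (0 < M)%N -> (0 < D)%N ->
  #|[set f : code | \bigcup_(w in W) code_nb f w \subset Y]|%:R <=
  #|{: code}|%:R * (#|Y|%:R / (D * M)%:R) ^+ (D * #|W|) :> R.
Proof.
move=> M0 D0.
pose F (e : 'I_d * 'I_D) := [pred y : 'I_M | (e.1 \in W) ==> ((e.2, y) \in Y)].
pose ys s := #|[set y : 'I_M | (s, y) \in Y]|.
have MR : 0 < M%:R :> R by rewrite ltr0n.
have DR : 0 < D%:R :> R by rewrite ltr0n.
have -> : #|[set f : code | \bigcup_(w in W) code_nb f w \subset Y]| = #|family F|.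
  apply: eq_card => f; rewrite inE; apply/bigcupsP/familyP => [h [w s]|h w wW].
    by rewrite inE; apply/implyP => /= /h /subsetP; apply; apply: imset_f.
  apply/subsetP => _ /imsetP[s _ ->].
  by have := h (w, s); rewrite inE /= wW.
rewrite card_family.
have -> : foldr muln 1%N [seq #|F x| | x : 'I_d * 'I_D] = (\prod_e #|F e|)%N.
  by rewrite foldrE big_map big_enum.
have Fin w s : w \in W -> #|F (w, s)| = ys s.
  by move=> wW; apply: eq_card => y; rewrite !inE /= wW.
have Fout w s : w \notin W -> #|F (w, s)| = M.
  move=> wW; rewrite -[RHS]card_ord; apply: eq_card => y.
  by rewrite !inE /= (negbTE wW).
have prodE : (\prod_e #|F e|)%:R =
   ((\prod_s ys s)%:R / M%:R ^+ D) ^+ #|W| * (M%:R ^+ D) ^+ d :> R.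
  have -> : (\prod_e #|F e| = \prod_w \prod_s #|F (w, s)|)%N.
    by rewrite pair_bigA; apply: eq_bigr => -[].
  rewrite (bigID (mem W)) /= (eq_bigr (fun=> \prod_s ys s)%N); last first.
    by move=> w wW; apply: eq_bigr => s _; rewrite Fin.
  rewrite [X in (_ * X)%N](eq_bigr (fun=> M ^ D)%N); last first.
    move=> w wW; rewrite (eq_bigr (fun=> M)) ?prod_nat_const ?card_ord //.
    by move=> s _; rewrite Fout.
  rewrite !prod_nat_const natrM !natrX.
  have dE : (d = #|W| + #|[predC W]|)%N by rewrite cardC card_ord.
  rewrite [X in _ = _ * _ ^+ X]dE exprD mulrA -exprMn divfK //.
  by rewrite expf_neq0 // gt_eqF.
rewrite prodE card_ffun card_prod !card_ord natrX [(d * D)%N]mulnC exprM.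
rewrite mulrC ler_wpM2l ?exprn_ge0 ?ler0n // exprM.
rewrite lerXn2r ?nnegrE ?exprn_ge0 ?divr_ge0 ?exprn_ge0 ?ler0n //.
have sumys : (\sum_s ys s = #|Y|)%N.
  rewrite -[RHS]sum1_card [RHS]big_mkcond /=.
  rewrite [RHS](eq_bigr (fun p => if (p.1, p.2) \in Y then 1 else 0)%N); last by case.
  rewrite -(pair_bigA _ (fun s y => if (s, y) \in Y then 1 else 0)%N) /=.
  apply: eq_bigr => s _; rewrite /ys -sum1_card big_mkcond /=.
  by apply: eq_bigr => y _; rewrite inE.
have := leif_AGM (E := fun s => (ys s)%:R : R) (A := {: 'I_D}) (fun s _ => ler0n _ _).
rewrite card_ord -natr_sum -natr_prod sumys => agm.
rewrite natrM invfM mulrA expr_div_n.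
by rewrite ler_wpM2r ?invr_ge0 ?exprn_ge0 ?ler0n //; case: agm.
Qed.

End RandomExpander.

(** Enlarges a neighbourhood that is too small to a prescribed size, so that the union bound uses a
    single size of [Y] for each [W]. *)
Lemma superset_card (T : finType) (A : {set T}) y :
  (#|A| <= y <= #|T|)%N -> exists2 Y : {set T}, A \subset Y & #|Y| = y.
Proof.
move=> /andP[]; have [m] := ubnP (y - #|A|)%N; elim: m A => // m IH A ltm Ay yT.
have [e|ne] := eqVneq #|A| y; first by exists A.
have [x xA] : exists x, x \notin A.
  apply/existsP; apply: contraT; rewrite negb_exists => /forallP h.
  have : #|A| = #|T| by apply: eq_card => x; move: (h x); rewrite negbK => ->.
  by lia.
have cA : #|x |: A| = #|A|.+1 by rewrite cardsU1 xA.
have [||//|Y AY <-] := IH (x |: A); [by rewrite cA; lia|by rewrite cA; lia|].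
by exists Y => //; apply: subset_trans AY; apply: subsetUr.
Qed.

Lemma geometric_quarter (R : realFieldType) n :
  \sum_(i < n) (1/4 : R) ^+ i.+1 = 1/3 * (1 - (1/4) ^+ n).
Proof.
elim: n => [|n IH]; first by rewrite big_ord0 expr0; ring.
by rewrite big_ord_recr /= IH exprS; field.
Qed.

Section RandomExpanderExists.
Variables (R : realType) (d g K M : nat).
Hypotheses (g0 : (0 < g)%N) (K0 : (0 < K)%N).
Hypothesis KM : expR 32 * K%:R <= M%:R :> R.
Hypothesis dK : 4 * expR 1 * d%:R <= K%:R * expR g%:R :> R.

(** Split the exponent as [32 g w = 31 g w + g w]. The first part cancels the binomial up to
    [e^(31 g w)]; the second is at most [(w / M)^(g w)], and [M >= e^32 K] absorbs those
    exponentials with a factor [e^(- g w)] to spare. With ['C(d, w) <= (e d / w)^w] this leaves at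
    most [(e d / (K e^g))^w], and [dK] is what makes the base at most [1/4]. *)
Lemma union_bound_term w : (0 < w)%N -> (w <= K)%N ->
  'C(d, w)%:R * ('C(32 * g * M, 31 * g * w)%:R *
    ((31 * g * w)%:R / (32 * g * M)%:R) ^+ (32 * g * w)) <= (1/4 : R) ^+ w.
Proof.
move=> w0 wK.
have wR : 0 < w%:R :> R by rewrite ltr0n.
have KR : 0 < K%:R :> R by rewrite ltr0n.
have gR : 0 < g%:R :> R by rewrite ltr0n.
have MR : 0 < M%:R :> R by apply: lt_le_trans KM; rewrite mulr_gt0 // expR_gt0.
have e0 : 0 < expR 1 :> R by exact: expR_gt0.
set y := (31 * g * w)%N; set Z := (32 * g * M)%N.
have yR : 0 < y%:R :> R by rewrite /y !natrM !mulr_gt0 // ltr0n.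
have ZR : 0 < Z%:R :> R by rewrite /Z !natrM !mulr_gt0 // ltr0n.
have q1 : 'C(Z, y)%:R * (y%:R / Z%:R) ^+ (32 * g * w) <=
    (w%:R / (expR 1 * K%:R)) ^+ (g * w) :> R.
  have -> : (32 * g * w = y + g * w)%N by rewrite /y; lia.
  rewrite exprD mulrA.
  have h1 : 'C(Z, y)%:R * (y%:R / Z%:R) ^+ y <= expR 1 ^+ y :> R.
    rewrite expr_div_n mulrA ler_pdivrMr ?exprn_gt0 //.
    exact: bin_bound.
  have h2 : (y%:R / Z%:R) ^+ (g * w) <= (w%:R / M%:R) ^+ (g * w) :> R.
    rewrite lerXn2r ?nnegrE ?divr_ge0 ?ler0n // ler_pdivrMr //.
    rewrite mulrAC ler_pdivlMr // -!natrM ler_nat /y /Z.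
    rewrite [leqLHS](_ : _ = 31 * (g * w * M))%N; last by ring.
    by rewrite [leqRHS](_ : _ = 32 * (g * w * M))%N ?leq_mul2r ?orbT //; ring.
  apply: le_trans (ler_pM _ _ h1 h2) _.
  - by rewrite mulr_ge0 ?ler0n ?exprn_ge0 ?divr_ge0 ?ler0n.
  - by rewrite exprn_ge0 ?divr_ge0 ?ler0n.
  rewrite /y -mulnA exprM -exprMn lerXn2r ?nnegrE //.
  rewrite ler_pdivlMr ?mulr_gt0 //.
  have -> : expR 1 ^+ 31 * (w%:R / M%:R) * (expR 1 * K%:R) =
    w%:R * (expR 1 ^+ 32 * K%:R) / M%:R :> R.
    by rewrite [_ ^+ 32]exprSr; ring.
  by rewrite ler_pdivrMr // ler_pM2l // -expRM_natl mulr1.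
have q2 : 'C(d, w)%:R <= (expR 1 * d%:R / w%:R) ^+ w :> R.
  rewrite expr_div_n ler_pdivlMr ?exprn_gt0 // exprMn; exact: bin_bound.
apply: le_trans (ler_pM _ _ q2 q1) _; first by rewrite ler0n.
  by rewrite mulr_ge0 ?ler0n ?exprn_ge0 ?divr_ge0 ?ler0n.
rewrite exprM -exprMn lerXn2r ?nnegrE ?mulr_ge0 ?divr_ge0 ?exprn_ge0 ?divr_ge0 ?mulr_ge0 ?ler0n ?(ltW e0) //.
have h3 : (w%:R / (expR 1 * K%:R)) ^+ g <= w%:R / K%:R / expR g%:R :> R.
  rewrite invfM mulrCA mulrC exprMn exprVn -expRM_natl mulr1.
  rewrite ler_wpM2r ?invr_ge0 ?expR_ge0 // -[leRHS]expr1.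
  by rewrite ler_wiXn2l ?divr_ge0 ?ler0n // ler_pdivrMr // mul1r ler_nat.
apply: le_trans (ler_wpM2l _ h3) _.
  by rewrite divr_ge0 ?mulr_ge0 ?ler0n // ltW.
have -> : expR 1 * d%:R / w%:R * (w%:R / K%:R / expR g%:R) =
  expR 1 * d%:R / (K%:R * expR g%:R) :> R.
  by field; rewrite !gt_eqF // expR_gt0.
rewrite ler_pdivrMr ?mulr_gt0 ?expR_gt0 //; move: dK; rewrite -mulrA.
by set a := expR 1 * _; set b := K%:R * _; lra.
Qed.

(** A failing code confines some nonempty [W] to [31 g |W|] rows. Grouped by the size of [W], the
    failing proportion is at most a geometric series of ratio [1/4], hence below 1. *)
Lemma exists_code : exists f : {ffun 'I_d * 'I_(32 * g) -> 'I_M},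
  forall W : {set 'I_d}, (#|W| <= K)%N ->
  (31 * (32 * g) * #|W| <= 32 * #|\bigcup_(w in W) code_nb f w|)%N.
Proof.
set D := (32 * g)%N; pose code : finType := {ffun 'I_d * 'I_D -> 'I_M}.
have MR : 0 < M%:R :> R.
  by apply: lt_le_trans KM; rewrite mulr_gt0 ?ltr0n // expR_gt0.
have M0 : (0 < M)%N by rewrite -(ltr0n R).
have KM' : (K <= M)%N.
  rewrite -(ler_nat R); apply: le_trans KM; rewrite ler_peMl ?ler0n //.
  by rewrite -expR0 ler_expR.
have D0 : (0 < D)%N by rewrite muln_gt0.
pose good (f : code) := [forall W : {set 'I_d}, (#|W| <= K)%N ==>
  (31 * D * #|W| <= 32 * #|\bigcup_(w in W) code_nb f w|)%N].
have [f /forallP gf|bad] := pickP good.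
  by exists f => W WK; apply: (implyP (gf W)).
pose conf (W : {set 'I_d}) (Y : {set 'I_D * 'I_M}) :=
  [set f : code | \bigcup_(w in W) code_nb f w \subset Y].
pose y w := (31 * g * w)%N.
have cover (f : code) : exists W : {set 'I_d}, exists Y : {set 'I_D * 'I_M},
    [/\ (0 < #|W| <= K)%N, #|Y| == y #|W| & f \in conf W Y].
  move: (bad f) => /negbT; rewrite negb_forall => /existsP[W].
  rewrite negb_imply -ltnNge => /andP[WK lt].
  have W0 : (0 < #|W|)%N by case: (#|W|) lt => //; rewrite muln0.
  have [|Y sY cY] := @superset_card _ (\bigcup_(w in W) code_nb f w) (y #|W|).
    rewrite card_prod !card_ord /y /D; apply/andP; split.
      have : (32 * #|\bigcup_(w in W) code_nb f w| < 32 * (31 * g * #|W|))%N.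
        by apply: leq_trans lt _; rewrite /D; apply/eq_leq; ring.
      by rewrite ltn_mul2l => /andP[_ /ltnW].
    by apply: leq_mul; [rewrite leq_mul2r orbT|exact: leq_trans KM'].
  by exists W, Y; split; rewrite ?W0 ?cY // inE.
pose Om : R := #|{: code}|%:R.
have Om0 : 0 < Om.
  by rewrite ltr0n card_ffun card_prod !card_ord expn_gt0 M0.
have b1 : Om <= \sum_(W : {set 'I_d} | (0 < #|W| <= K)%N)
    \sum_(Y : {set 'I_D * 'I_M} | #|Y| == y #|W|) #|conf W Y|%:R.
  have -> : Om = \sum_(f : code) 1 by rewrite sumr_const.
  apply: le_trans (_ : \sum_(f : code) \sum_(W : {set 'I_d} | (0 < #|W| <= K)%N)
    \sum_(Y : {set 'I_D * 'I_M} | #|Y| == y #|W|) (f \in conf W Y)%:R <= _).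
    apply: ler_sum => f _; have [W [Y [hW hY hf]]] := cover f.
    rewrite (bigD1 W) //= (bigD1 Y) //= hf -addrA lerDl.
    by rewrite addr_ge0 // !sumr_ge0 // => *; rewrite ?sumr_ge0 // => *; rewrite ler0n.
  rewrite exchange_big /=; apply: ler_sum => W _.
  rewrite exchange_big /=; apply: ler_sum => Y _.
  rewrite -sum1_card natr_sum [leRHS]big_mkcond; apply: ler_sum => f _.
  by case: (f \in _).
have b2 : Om <= \sum_(W : {set 'I_d} | (0 < #|W| <= K)%N)
    Om * ('C(32 * g * M, y #|W|)%:R *
      ((y #|W|)%:R / (32 * g * M)%:R) ^+ (32 * g * #|W|)).
  apply: le_trans b1 _; apply: ler_sum => W _.
  apply: le_trans (_ : \sum_(Y : {set 'I_D * 'I_M} | #|Y| == y #|W|)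
     Om * ((y #|W|)%:R / (32 * g * M)%:R) ^+ (32 * g * #|W|) <= _).
    by apply: ler_sum => Y /eqP <-; apply: card_confined.
  rewrite sumr_const.
  have -> : #|(fun Y : {set 'I_D * 'I_M} => #|Y| == y #|W|)| = 'C(D * M, y #|W|).
    have -> : (D * M = #|{: 'I_D * 'I_M}|)%N by rewrite card_prod !card_ord.
    by rewrite -card_draws; apply: eq_card => Y; rewrite inE.
  by rewrite -[leLHS]mulr_natr -mulrA [X in _ * X]mulrC.
move: b2; rewrite -mulr_sumr -{1}[Om]mulr1 ler_pM2l //.
rewrite (partition_big (fun W : {set 'I_d} => inord #|W|)
  (fun w : 'I_d.+1 => (0 < w <= K)%N)) /=; last first.
  by move=> W; rewrite inordK // ltnS -[leqRHS]card_ord max_card.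
move=> b3; suff : \sum_(w < d.+1 | (0 < w <= K)%N) (1/4 : R) ^+ w < 1.
  rewrite ltNge; case/negP; apply: le_trans b3 _; apply: ler_sum => w /andP[w0 wK].
  apply: le_trans (union_bound_term w0 wK).
  rewrite (eq_bigr (fun=> 'C(32 * g * M, y w)%:R *
      ((y w)%:R / (32 * g * M)%:R) ^+ (32 * g * w))); last first.
    move=> W /andP[_ /eqP <-]; rewrite inordK // ltnS.
    by rewrite -[leqRHS]card_ord max_card.
  rewrite sumr_const -[leLHS]mulr_natl ler_wpM2r //.
  have -> : 'C(d, w) = #|[set W : {set 'I_d} | #|W| == w]|.
    by rewrite card_draws card_ord.
  rewrite ler_nat; apply/subset_leq_card/subsetP => W.
  rewrite inE unfold_in => /andP[_ /eqP <-]; rewrite inordK // ltnS.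
  by rewrite -[leqRHS]card_ord max_card.
apply: le_lt_trans (_ : \sum_(i < d) (1/4 : R) ^+ i.+1 < 1); last first.
  rewrite geometric_quarter; have : 0 < (1/4 : R) ^+ d by rewrite exprn_gt0.
  by lra.
rewrite big_mkcond big_ord_recl /= add0r; apply: ler_sum => i _.
by case: ifP => // _; rewrite exprn_ge0.
Qed.

Lemma random_expander : exists nb : 'I_d -> {set 'I_(32 * g * M)},
  (forall w, #|nb w| = (32 * g)%N) /\ expanding (32 * g) nb K.
Proof.
have [f hf] := exists_code.
have rc : #|{: 'I_(32 * g) * 'I_M}| = (32 * g * M)%N.
  by rewrite card_prod !card_ord.
pose h (p : 'I_(32 * g) * 'I_M) : 'I_(32 * g * M) := cast_ord rc (enum_rank p).
have hI : injective h by move=> p q /cast_ord_inj /enum_rank_inj.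
exists (fun w => h @: code_nb f w); split=> [w|W /hf].
  by rewrite card_imset // card_code_nb.
congr (_ <= _)%N; congr (_ * _)%N; rewrite -(card_imset _ hI).
apply: eq_card => i; apply/imsetP/bigcupP.
  move=> [p /bigcupP[w wW pw] ->]; exists w => //; exact: imset_f.
by move=> [w wW /imsetP[p pw ->]]; exists p => //; apply/bigcupP; exists w.
Qed.

End RandomExpanderExists.

(** * Sparse recovery from the null space property *)

Section Recovery.
Variables (R : realType) (m n : nat) (A : 'M[R]_(m, n)).

(** Any factor below [1/2] would give recovery; [1/4] leads to the constants [4] and [8 * tau]. *)
Definition robust_nsp (s : nat) (tau : R) :=
  forall (x : 'cV[R]_n) (S : {set 'I_n}), (#|S| <= s)%N ->
  \sum_(i in S) `|x i 0| <= 1 / 4 * l1norm x + tau * l1norm (A *m x).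

Lemma l1normN k (x : 'cV[R]_k) : l1norm (- x) = l1norm x.
Proof. by apply: eq_bigr => i _; rewrite mxE normrN. Qed.

Lemma l1norm_split (x : 'cV[R]_n) (S : {set 'I_n}) : l1norm x =
  \sum_(i in S) `|x i 0| + \sum_(i | i \notin S) `|x i 0|.
Proof. exact: bigID. Qed.

(** Minimality of [z] gives that [h] off [S] has at most the mass of [h] on [S] plus twice that of
    [x] off [S]. The null space property then yields [|h| <= |h| / 2 + 2 tau |A h| + 2 sigma], where
    [|A h| <= 2 eta]. Keeping [cmp] abstract treats the strict and the closed problem at once. *)
Lemma robust_nsp_valid (cmp : rel R) (s : nat) (tau eta : R) :
  (forall a b, cmp a b -> a <= b) -> 0 <= tau -> robust_nsp s tau ->
  l1_outputs_valid cmp 4 (8 * tau) A s eta.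
Proof.
move=> cmpW tau0 nsp x e ce z [fz minz]; rewrite /l1l1_guarantee.
set y := A *m x + e in fz minz.
have yx : y - A *m x = e by rewrite /y addrC addKr.
have zx : l1norm z <= l1norm x by apply: minz; rewrite yx.
set h := z - x.
have Ah : l1norm (A *m h) <= 2 * eta.
  have -> : A *m h = e + - (y - A *m z).
    by rewrite /h mulmxBr -{1}yx opprB [RHS]addrC addrA subrK.
  apply: le_trans (l1normD _ _) _; rewrite l1normN.
  by have := cmpW _ _ ce; have := cmpW _ _ fz; lra.
suff : (l1norm h - 8 * tau * eta) / 4 <= sigma1 s x by lra.
(* No best approximation is needed: the bound is proved against every sparse [w], with [S] its
   support, off which [x - w] equals [x]. *)
apply: lb_le_inf.
  exists (l1norm (x - 0)); exists 0 => //=; rewrite /sparse /=.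
  rewrite eq_card0 // => i; rewrite inE mxE eqxx //.
move=> _ [w /= sw <-].
pose S := [set i | w i 0 != 0].
have S1 : (#|S| <= s)%N by apply: leq_trans sw; apply/eq_leq/eq_card => i; rewrite !inE.
have h1 := nsp h S S1.
have h2 : \sum_(i | i \notin S) `|x i 0| <= l1norm (x - w).
  rewrite (l1norm_split _ S) -[leLHS]add0r lerD ?sumr_ge0 //.
  apply: ler_sum => i; rewrite inE negbK => /eqP wi.
  by rewrite !mxE wi subr0.
have zE i : z i 0 = x i 0 + h i 0 by rewrite /h !mxE; ring.
have h3 : \sum_(i in S) `|x i 0| - \sum_(i in S) `|h i 0| <= \sum_(i in S) `|z i 0|.
  rewrite -sumrB; apply: ler_sum => i _; rewrite zE.
  by have := ler_normB (x i 0 + h i 0) (h i 0); rewrite addrK; lra.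
have h4 : \sum_(i | i \notin S) `|h i 0| - \sum_(i | i \notin S) `|x i 0| <=
    \sum_(i | i \notin S) `|z i 0|.
  rewrite -sumrB; apply: ler_sum => i _; rewrite zE.
  by have := ler_normB (x i 0 + h i 0) (x i 0); rewrite addrC addKr; lra.
have tA : tau * l1norm (A *m h) <= tau * (2 * eta) by rewrite ler_wpM2l.
move: zx h1; rewrite (l1norm_split z S) (l1norm_split x S) (l1norm_split h S).
by lra.
Qed.

Lemma continuous_sumr (T : topologicalType) k (F : 'I_k -> T -> R) :
  (forall i, continuous (F i)) -> continuous (fun v => \sum_i F i v).
Proof.
by move=> cF; apply: continuous_big => [|i _]; [exact: add_continuous|exact: cF].
Qed.

(** As [x] is feasible, only vectors of norm at most [|x|_1] matter; they lie in a box, whose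
    feasible part is compact. *)
Lemma l1_output_exists_closed (eta : R) : l1_output_exists <=%R A eta.
Proof.
move=> x e he; set y := A *m x + e.
pose M := l1norm x.
pose res (v : 'rV[R]_n) := l1norm (y - A *m v^T).
pose box := [set v : 'rV[R]_n | forall i, `[- M, M] (v ord0 i)]%classic.
pose feas := [set v : 'rV[R]_n | res v <= eta]%classic.
have box_compact : compact box.
  apply: (@rV_compact _ _ (fun=> `[- M, M]%classic)) => _.
  exact: segment_compact.
have coordc j : continuous (fun v : 'rV[R]_n => v 0 j) by exact: coord_continuous.
have res_cont : continuous res.
  have -> : res = fun v => \sum_i `|y i 0 - \sum_j A i j * v 0 j|.
    apply/funext => v; apply: eq_bigr => i _; rewrite !mxE.
    by congr (`|_ - _|); apply: eq_bigr => j _; rewrite mxE.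
  apply: continuous_sumr => i v.
  have lin : continuous (fun v : 'rV[R]_n => \sum_j A i j * v 0 j).
    apply: continuous_sumr => j u.
    by apply: (@continuousM _ _ (fun=> A i j)); [exact: cst_continuous|exact: coordc].
  apply: (@continuous_comp _ _ _ (fun v : 'rV[R]_n => y i 0 - \sum_j A i j * v 0 j)
    (fun a : R => `|a|)); last exact: norm_continuous.
  by apply: (@continuousB _ _ _ (fun=> y i 0)); [exact: cst_continuous|exact: lin].
have feas_closed : closed feas.
  by move/continuous_closedP/(_ _ (@closed_le R eta)): res_cont.
pose obj (v : 'rV[R]_n) := l1norm v^T.
have obj_cont : continuous obj.
  have -> : obj = fun v => \sum_i `|v 0 i|.
    by apply/funext => v; apply: eq_bigr => i _; rewrite mxE.
  apply: continuous_sumr => i v.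
  by apply: (@continuous_comp _ _ _ (fun v : 'rV[R]_n => v 0 i) (fun a : R => `|a|));
    [exact: coordc|exact: norm_continuous].
have in_box (v : 'rV[R]_n) : obj v <= M -> box v.
  move=> ov i /=; rewrite in_itv /= -ler_norml; apply: le_trans ov.
  rewrite /obj /l1norm (bigD1 i) //= mxE lerDl sumr_ge0 //.
have fx : feas x^T.
  by rewrite /feas /= /res trmxK /y addrC addKr.
have [|||c] := @compact_EVT_min _ _ obj (box `&` feas)%classic.
- by exists x^T; split => //; apply: in_box; rewrite /obj trmxK.
- exact: compact_closedI.
- by apply: continuous_subspaceT.
move=> /set_mem[bc fc] minc; exists c^T; split=> // w fw.
have [le|/ltW le] := lerP (l1norm w) M; last first.
  apply: le_trans le; have := minc x^T; rewrite /obj trmxK; apply.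
  by apply: mem_set; split => //; apply: in_box; rewrite /obj trmxK.
have := minc w^T; rewrite /obj trmxK; apply; apply: mem_set; split.
  by apply: in_box; rewrite /obj trmxK.
by rewrite /feas /= /res trmxK.
Qed.

Lemma robust_nsp_solved (s : nat) (tau eta : R) : 0 <= tau ->
  robust_nsp s tau -> solved_by_l1_minimization 4 (8 * tau) A s eta.
Proof.
move=> tau0 nsp; split.
- by apply: robust_nsp_valid => // a b /ltW.
- exact: l1_output_exists_closed.
- exact: robust_nsp_valid.
Qed.

End Recovery.

(** * Coding of vertices *)

Section Coding.
Local Open Scope nat_scope.

(** A base 4 digit stores one coefficient of each polynomial, the first in its high bit. *)
Definition nat_digit (u i : nat) : bool * bool :=
  (odd (u %/ 4 ^ i)./2, odd (u %/ 4 ^ i)).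
Definition digit_code (c : bool * bool) : nat := c.1.*2 + c.2.

Lemma nat_digit0 u c : c < 4 -> nat_digit (4 * u + c) 0 = (1 < c, odd c).
Proof.
by case: c => [|[|[|[|//]]]] _; rewrite /nat_digit divn1; congr (_, _); lia.
Qed.

Lemma nat_digitS u c i : c < 4 -> nat_digit (4 * u + c) i.+1 = nat_digit u i.
Proof.
move=> c4; rewrite /nat_digit expnS divnMA.
by rewrite (_ : (4 * u + c) %/ 4 = u) //; lia.
Qed.

Lemma sum_nat_digit k u :
  \sum_(i < k) digit_code (nat_digit u i) * 4 ^ i = u %% 4 ^ k.
Proof.
elim: k u => [|k IH] u; first by rewrite big_ord0 modn1.
have c4 : u %% 4 < 4 by rewrite ltn_mod.
have uE : u = 4 * (u %/ 4) + u %% 4 by rewrite mulnC -divn_eq.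
rewrite uE; move: (u %/ 4) (u %% 4) c4 => {uE}u c c4.
rewrite big_ord_recl /= nat_digit0 // expn0 muln1.
under eq_bigr => i _ do rewrite /bump /= add1n nat_digitS // expnS mulnCA.
rewrite -big_distrr /= IH.
have -> : digit_code (1 < c, odd c) = c by case: c c4 => [|[|[|[|//]]]].
rewrite [in RHS](divn_eq u (4 ^ k)) mulnDr mulnCA -expnS -addnA modnMDl addnC.
have := ltn_pmod u (_ : 0 < 4 ^ k); rewrite expn_gt0 => /(_ isT) lt.
by rewrite [RHS]modn_small //; rewrite expnS; lia.
Qed.

Variable r : nat.
Notation vertex := {ffun 'I_r.+1 -> bool * bool}.

Definition decode (u : nat) : vertex := [ffun i : 'I_r.+1 => nat_digit u i].
Definition encode (v : vertex) : nat := \sum_(i < r.+1) digit_code (v i) * 4 ^ i.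

Lemma decodeK u : u < 4 ^ r.+1 -> encode (decode u) = u.
Proof.
move=> ur; rewrite /encode; under eq_bigr => i _ do rewrite ffunE.
by rewrite sum_nat_digit modn_small.
Qed.

Lemma encodeK : cancel encode decode.
Proof.
pose f (u : 'I_(4 ^ r.+1)) := decode u.
have fI : injective f.
  by move=> u v /(congr1 encode); rewrite !decodeK // => /val_inj.
have [g fg gf] : bijective f.
  by apply: inj_card_bij => //; rewrite card_vertex card_ord.
by move=> v; rewrite -[v in RHS]gf -[v in LHS]gf /f decodeK.
Qed.

Lemma encode_lt v : encode v < 4 ^ r.+1.
Proof.
pose f (u : 'I_(4 ^ r.+1)) := decode u.
have fI : injective f.
  by move=> u w /(congr1 encode); rewrite !decodeK // => /val_inj.
have [g fg gf] : bijective f.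
  by apply: inj_card_bij => //; rewrite card_vertex card_ord.
by rewrite -(gf v) /f decodeK.
Qed.

Lemma decode0 : encode (decode 0) = 0.
Proof. by rewrite decodeK // expn_gt0. Qed.

Lemma digit_decode u j : j <= r -> digit (decode u) j = nat_digit u j.
Proof. by move=> jr; rewrite /digit insubT // ffunE. Qed.

Lemma digit_decode_out u j : u < 4 ^ r -> r <= j ->
  digit (decode u) j = (false, false).
Proof.
move=> ur; rewrite leq_eqVlt => /orP[/eqP <-|rj]; last by rewrite digit_out.
by rewrite digit_decode // /nat_digit divn_small.
Qed.

Lemma encodeS (v v' : vertex) :
  (forall j, j < r -> digit v j.+1 = digit v' j) ->
  digit v' r = (false, false) -> encode v = 4 * encode v' + digit_code (v ord0).
Proof.
move=> h top; rewrite /encode big_ord_recl [in RHS]big_ord_recr /= expn0 muln1.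
have -> : v' ord_max = (false, false) by rewrite -top (digitE v' ord_max).
rewrite mul0n addn0 addnC big_distrr /=; congr addn; apply: eq_bigr => i _.
have := h i (ltn_ord i); rewrite -(digitE v (lift ord0 i)).
rewrite -(digitE v' (widen_ord (leqnSn r) i)) /= /bump /= add1n => ->.
by rewrite expnS; ring.
Qed.

Definition table (l u : nat) : nat := encode (letter l (decode u)).

Section TableRecursion.
Variables (u c : nat).
Hypotheses (c4 : c < 4) (ur : u < 4 ^ r).

Let shift_digit j : j < r -> digit (decode (4 * u + c)) j.+1 = digit (decode u) j.
Proof. by move=> jr; rewrite !digit_decode ?(ltnW jr) // nat_digitS. Qed.

Let digit0 : decode (4 * u + c) ord0 = (1 < c, odd c).
Proof. by rewrite ffunE nat_digit0. Qed.

Let digit_map (h : vertex -> vertex) g :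
  (forall v i, h v i = g (v i)) -> g (false, false) = (false, false) ->
  encode (h (decode (4 * u + c))) =
    4 * encode (h (decode u)) + digit_code (g (1 < c, odd c)).
Proof.
move=> hg g0.
have hd v j : digit (h v) j = g (digit v j).
  by rewrite /digit; case: insubP => [i _ _|_]; rewrite ?hg.
rewrite -digit0 -hg; apply: encodeS => [j jr|]; rewrite !hd.
  by rewrite shift_digit.
by rewrite digit_decode_out.
Qed.

(** Such recursions let the machine fill the tables by additions, without extracting digits. The
    bound [u < 4 ^ r] ensures that appending a digit pushes none out. *)
Lemma table_swap : table 0 (4 * u + c) = 4 * table 0 u + digit_code (odd c, 1 < c).
Proof. by apply: (digit_map (g := fun x => (x.2, x.1))) => // v i; rewrite ffunE. Qed.

Lemma table_add :
  table 1 (4 * u + c) = 4 * table 1 u + digit_code ((1 < c) (+) odd c, odd c).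
Proof.
by apply: (digit_map (g := fun x => (x.1 (+) x.2, x.2))) => // v i; rewrite ffunE.
Qed.

(** Here neighbouring digits interact: digit 0 receives the low bit of digit 1, the parity of [u],
    which is why the program keeps an array of parities. *)
Lemma table_shift :
  table 2 (4 * u + c) = 4 * table 2 u + digit_code ((1 < c) (+) odd u, odd c).
Proof.
rewrite /table /=.
have dS (v : vertex) j : j <= r ->
    digit (shiftv v) j = ((digit v j).1 (+) (digit v j.+1).2, (digit v j).2).
  move=> jr; have jr' : j < r.+1 by [].
  have := digitE v (Ordinal jr'); have := digitE (shiftv v) (Ordinal jr').
  by rewrite /= => -> ->; rewrite ffunE.
have -> : ((1 < c) (+) odd u, odd c) = shiftv (decode (4 * u + c)) ord0.
  rewrite ffunE digit0 /=; congr (_ (+) _, _).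
  case: (posnP r) => [r0|r0].
    rewrite digit_out ?r0 //=; move: ur; rewrite r0 expn0.
    by case: u.
  by rewrite shift_digit // digit_decode // /nat_digit divn1.
apply: encodeS => [j jr|].
  rewrite !dS ?(ltnW jr) // shift_digit //.
  case: (ltnP j.+1 r) => [jr'|rj]; first by rewrite shift_digit.
  by rewrite (@digit_out _ _ j.+2) // [digit _ j.+1]digit_decode_out.
by rewrite dS // !digit_decode_out.
Qed.

End TableRecursion.

Lemma table_flip u : u < 2 * 4 ^ r ->
  table 3 u = u + 2 * 4 ^ r /\ table 3 (u + 2 * 4 ^ r) = u.
Proof.
move=> ur; have e1 : table 3 u = u + 2 * 4 ^ r.
  have uN : u < 4 ^ r.+1 by rewrite expnS; lia.
  rewrite /table /= -[u in RHS](decodeK uN) /encode !big_ord_recr /=.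
  rewrite !ffunE eqxx /nat_digit /=.
  have -> : odd (u %/ 4 ^ r)./2 = false.
    have : u %/ 4 ^ r < 2 by rewrite ltn_divLR // expn_gt0.
    by case: (u %/ 4 ^ r) => [|[|//]].
  rewrite /= -addnA; congr addn; last first.
    by rewrite /digit_code /=; case: (odd _); rewrite /= -mulnDl.
  apply: eq_bigr => i _; rewrite !ffunE (_ : (_ == _) = false) ?addbF //.
  by apply/eqP => /(congr1 val) /= e; move: (ltn_ord i); rewrite e ltnn.
split=> //; rewrite -e1 /table /= encodeK flipvK decodeK //.
by rewrite expnS; lia.
Qed.

End Coding.

(** * The construction program *)

Notation var a := (Cell a (Const 0)).

(** * Total correctness triples with a bound on the running time *)

Section TotalCorrectness.
Local Open Scope nat_scope.

Definition triple (P : store -> Prop) (c : cmd) (T : nat) (Q : store -> Prop) :=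
  forall st, P st -> exists t st', [/\ run c st t st', t <= T & Q st'].

Lemma triple_weaken P c T Q (P' Q' : store -> Prop) T' : triple P c T Q ->
  (forall st, P' st -> P st) -> (forall st, Q st -> Q' st) -> T <= T' ->
  triple P' c T' Q'.
Proof.
move=> h hP hQ TT' st /hP /h[t [st' [r1 r2 r3]]]; exists t, st'.
by split=> //; [exact: leq_trans TT'|exact: hQ].
Qed.

Lemma triple_skip P : triple P Skip 1 P.
Proof. by move=> st Pst; exists 1, st; split=> //; exact: RunSkip. Qed.

Lemma triple_assign P a e f Q :
  (forall st, P st -> Q (update st a (eval st e) (eval st f))) ->
  triple P (Assign a e f) 1 Q.
Proof.
by move=> h st /h Qst; eexists 1, _; split; [exact: RunAssign| |exact: Qst].
Qed.

Lemma triple_seq P c1 T1 Q c2 T2 S :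
  triple P c1 T1 Q -> triple Q c2 T2 S -> triple P (Seq c1 c2) (T1 + T2) S.
Proof.
move=> h1 h2 st /h1[t1 [st1 [r1 l1 /h2[t2 [st2 [r2 l2 s2]]]]]].
by exists (t1 + t2), st2; split=> //; [apply: RunSeq r1 r2|apply: leq_add].
Qed.

Lemma triple_if P e c1 c2 T Q :
  triple (fun st => P st /\ 0 < eval st e) c1 T Q ->
  triple (fun st => P st /\ eval st e = 0) c2 T Q ->
  triple P (IfPos e c1 c2) T.+1 Q.
Proof.
move=> h1 h2 st Pst; have [e0|e0] := posnP (eval st e).
  have [t [st' [r1 l1 q1]]] := h2 st (conj Pst e0).
  by exists t.+1, st'; split=> //; exact: RunIfFalse.
have [t [st' [r1 l1 q1]]] := h1 st (conj Pst e0).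
by exists t.+1, st'; split=> //; exact: RunIfTrue.
Qed.

(** The invariant is indexed by the number of iterations done and determines the test, so
    termination and the exact number of rounds come together. *)
Lemma triple_while (I : nat -> store -> Prop) e c T m :
  (forall k, k < m -> triple (I k) c T (I k.+1)) ->
  (forall k st, k <= m -> I k st -> (0 < eval st e) = (k < m)) ->
  triple (I 0) (WhilePos e c) (m * T.+1).+1 (I m).
Proof.
move=> hc he; suff h j k : k + j = m -> triple (I k) (WhilePos e c) (j * T.+1).+1 (I m).
  exact: h.
elim: j k => [|j IH] k kj st Ik.
  exists 1, st; rewrite -kj addn0; split=> //; apply: RunWhileFalse.
  by apply/eqP; rewrite -leqn0 leqNgt (he k) ?ltn_neqAle -?kj ?addn0 ?eqxx.
have km : k < m by lia.
have [t [st1 [r1 l1 I1]]] := hc k km st Ik.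
have [|t2 [st2 [r2 l2 I2]]] := IH k.+1 _ st1 I1; first by lia.
exists (t + t2).+1, st2; split=> //; last by rewrite mulSn; lia.
by apply: RunWhileTrue r1 r2; rewrite (he k) // ltnW.
Qed.

(** Iterations over ranges independent of [n] (words, local rows, base 4 digits) are unrolled into
    the program text. *)
Definition seqc (l : seq cmd) : cmd := foldr Seq Skip l.

Lemma triple_seqc (X : Type) (f : X -> cmd) (xs : seq X) T
    (J : seq X -> store -> Prop) :
  (forall ys x zs, xs = ys ++ x :: zs -> triple (J ys) (f x) T (J (rcons ys x))) ->
  triple (J [::]) (seqc (map f xs)) (size xs * T).+1 (J xs).
Proof.
move=> h; suff H zs ys : xs = ys ++ zs ->
    triple (J ys) (seqc (map f zs)) (size zs * T).+1 (J xs) by exact: H.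
elim: zs ys => [|x zs IH] ys e /=; first by rewrite e cats0; exact: triple_skip.
rewrite mulSn -addnS; apply: triple_seq (h ys x zs e) _.
by apply: IH; rewrite cat_rcons.
Qed.

Definition scale (k : nat) (e : expr) : expr := iter k (Plus e) (Const 0).

Lemma eval_plus st e f : eval st (Plus e f) = eval st e + eval st f.
Proof. by []. Qed.

Lemma eval_minus st e f : eval st (Minus e f) = eval st e - eval st f.
Proof. by []. Qed.

Lemma eval_cell st a e : eval st (Cell a e) = st a (eval st e).
Proof. by []. Qed.

Lemma eval_const st k : eval st (Const k) = k.
Proof. by []. Qed.

Lemma eval_scale st k e : eval st (scale k e) = k * eval st e.
Proof. by elim: k => //= k ->; rewrite mulSn. Qed.

Definition evalE := (eval_plus, eval_minus, eval_cell, eval_const, eval_scale).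

Definition loop (test : expr) (body : cmd) : cmd :=
  Seq (Assign 4 (Const 0) (Const 0))
    (WhilePos test (Seq body (Assign 4 (Const 0) (Plus (var 4) (Const 1))))).

Lemma triple_loop (I : nat -> store -> Prop) (P : store -> Prop) test body T m :
  (forall st, P st -> I 0 st) ->
  (forall k st x, I k st -> I k (update st 4 0 x)) ->
  (forall k st, k <= m -> I k st -> st 4 0 = k -> (0 < eval st test) = (k < m)) ->
  (forall k, k < m -> triple (fun st => I k st /\ st 4 0 = k) body T
                             (fun st => I k.+1 st /\ st 4 0 = k)) ->
  triple P (loop test body) (m * T.+2 + 2) (I m).
Proof.
move=> I0 Iu ht hb.
pose J k st := I k st /\ st 4 0 = k.
apply: (@triple_weaken P _ (1 + (m * (T + 1).+1).+1) (J m)) => //; last first.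
- by rewrite addn1; lia.
- by move=> st [].
apply: (@triple_seq _ _ _ (J 0)).
  by apply: triple_assign => st /I0 h; split=> //; exact: Iu.
apply: triple_while => [k km|k st km [h1 h2]]; last exact: ht.
apply: triple_seq (hb k km) _; apply: triple_assign => st [h1 h2].
by split=> /=; [exact: Iu|rewrite /update /= h2 addn1].
Qed.

End TotalCorrectness.

Section Construction.
Local Open Scope nat_scope.
(* t.*2 is the length of the words, ml and rws describe the local matrix: the
   slot w has its ones in the rows of the list rws w. *)
Variables (t ml q a1 a3 : nat) (rws : nat -> seq nat).
Hypothesis q0 : 0 < q.
Let d := 8 ^ t.*2.

Definition depth (n : nat) : nat :=
  find (fun r => n <= 4 ^ r.+1 * d) (iota 0 n.+1).

Lemma depthP n : n <= 4 ^ (depth n).+1 * d.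
Proof.
have h : has (fun r => n <= 4 ^ r.+1 * d) (iota 0 n.+1).
  apply/hasP; exists n; first by rewrite mem_iota add0n /=.
  have d1 : 0 < d by rewrite expn_gt0.
  apply: leq_trans (leq_pmulr _ d1); apply: ltnW.
  by apply: ltn_trans (ltn_expl n (isT : 1 < 4)) _; rewrite ltn_exp2l.
have := nth_find 0 h; rewrite nth_iota ?add0n //.
by rewrite -[X in _ < X](size_iota 0 n.+1) -has_find.
Qed.

Lemma depth_lt n j : j < depth n -> 4 ^ j.+1 * d < n.
Proof.
move=> jd; have := before_find 0 jd; rewrite nth_iota ?add0n => [/negbT|].
  by rewrite -ltnNge.
by apply: leq_trans jd _; rewrite -[X in _ <= X](size_iota 0 n.+1) find_size.
Qed.

Lemma depth_le n : depth n <= n.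
Proof.
case: (leqP (depth n) n) => // lt; have := depth_lt lt.
rewrite ltnNge; case/negP; apply: leq_trans (leq_pmulr _ _); last by rewrite expn_gt0.
apply: ltnW; apply: ltn_trans (ltn_expl n (isT : 1 < 4)) _.
by rewrite ltn_exp2l.
Qed.

(** The next smaller graph has too few edges, so rounding up costs at most a factor 4; [maxn d]
    covers depth 0. *)
Lemma depth_small n : 4 ^ depth n * d <= maxn d n.
Proof.
case e: (depth n) => [|j]; first by rewrite expn0 mul1n leq_maxl.
have := @depth_lt n j; rewrite e ltnSn => /(_ isT) lt.
by rewrite leq_max (ltnW lt) orbT.
Qed.

Section FixedInput.
Variable n : nat.
Let r := depth n.
Let N := 4 ^ r.+1.
Let half := 2 * 4 ^ r.
Let tab := table r.

Definition word_nat (w v : nat) : nat :=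
  encode (act (nth [::] (words t.*2) w) (decode r v)).

(** Row-major positions. Rows come in blocks of [ml], block [v] for a left vertex and block [N + u]
    for a right one; column [v * d + w] is the edge at [v] labelled [w]. *)
Definition posL (v w i : nat) := v * (ml * n) + (i * n + (v * d + w)).
Definition posR (v w i : nat) := (N + word_nat w v) * (ml * n) + (i * n + (v * d + w)).
Definition ones_slot (v w : nat) : seq nat :=
  if v * d + w < n then flatten [seq [:: posL v w i; posR v w i] | i <- rws w]
  else [::].
Definition ones_vertex (v : nat) : seq nat :=
  flatten [seq ones_slot v w | w <- iota 0 d].
Definition ones_tanner : seq nat := flatten [seq ones_vertex v | v <- iota 0 N].
(** Consecutive ones just after the [2 * N] blocks, there to reach the prescribed number of nonzero
    entries. *)
Definition ones_pad (k : nat) : seq nat := iota (2 * N * (ml * n)) k.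
Definition ones : seq nat := ones_tanner ++ ones_pad (n %/ q * a3).

Definition out_is (s : seq nat) (st : store) := forall p, st 2 p = (p \in s) :> nat.

Lemma out_is_eq s s' st : s =i s' -> out_is s st -> out_is s' st.
Proof. by move=> e h p; rewrite h e. Qed.

Lemma out_is_write s st p : out_is s st -> out_is (rcons s p) (update st 2 p 1).
Proof.
by move=> h x; rewrite /update eqxx mem_rcons inE /=; case: eqP => //= _; rewrite h.
Qed.

(** Store layout: 3 holds [half], 4 the loop counter, 5 to 8 the tables of the letters 0 to 3, 9 the
    parities, 10 the offsets of the row blocks, 11 what remains of [n] in the division by [q], 12
    the next padding position. The test compares [n] with [2 * d * half], the number of edges. *)
Definition find_depth : cmd :=
  Seq (Assign 3 (Const 0) (Const 2))
    (WhilePos (Minus (var 0) (scale (2 * d) (var 3)))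
       (Assign 3 (Const 0) (scale 4 (var 3)))).

Definition blank st := st 0 0 = n /\ forall a i, a != 0 -> a != 3 -> st a i = 0.
Definition sized st := blank st /\ st 3 0 = half.

Lemma find_depth_correct :
  triple (fun st => st = input_store n) find_depth (2 * n + 2) sized.
Proof.
pose I k st := blank st /\ st 3 0 = 2 * 4 ^ k.
apply: (@triple_weaken (fun st => st = input_store n) _ (1 + (r * 2).+1) (I r)) => //.
  apply: (@triple_seq _ _ _ (I 0)).
    apply: triple_assign => st ->; split; last by rewrite /update /= expn0.
    split; first by rewrite /update /= /input_store /update.
    by move=> a i /negbTE a0 /negbTE a3'; rewrite /update a3' /input_store /update a0.
  apply: triple_while => [k kr|k st kr [[h0 hb] h3]].
    apply: triple_assign => st [[h0 hb] h3]; split; last first.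
      by rewrite !evalE /update /= h3 expnS; ring.
    split; first by rewrite /update /= h0.
    by move=> a i na /negbTE a3'; rewrite /update a3' hb // a3'.
  rewrite !evalE h0 h3 subn_gt0.
  have -> : 2 * d * (2 * 4 ^ k) = 4 ^ k.+1 * d by rewrite expnS; ring.
  have [kr'|] := ltnP k r; first by rewrite depth_lt.
  move=> rk; have -> : k = r by apply/eqP; rewrite eqn_leq kr.
  by rewrite ltnNge depthP.
have := depth_le n; rewrite -/r; lia.
Qed.

Definition entry (a c k : nat) : cmd :=
  Assign a (Plus (scale 4 (var 4)) (Const c))
           (Plus (scale 4 (Cell a (var 4))) (Const k)).

Definition shift_expr (c : nat) : expr :=
  Plus (scale 4 (Cell 7 (var 4)))
       (if 1 < c then Minus (Const c) (scale 2 (Cell 9 (var 4)))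
        else Plus (Const c) (scale 2 (Cell 9 (var 4)))).

Lemma eval_shift_expr st c k : c < 4 -> st 4 0 = k -> st 9 k = odd k :> nat ->
  eval st (shift_expr c) = 4 * st 7 k + digit_code ((1 < c) (+) odd k, odd c).
Proof.
move=> c4 h4 h9; case: c c4 => [|[|[|[|//]]]] _; rewrite /shift_expr !evalE h4 h9;
  by case: (odd k).
Qed.

Definition fill_slot (c : nat) : cmd :=
  seqc [:: entry 5 c (digit_code (odd c, 1 < c));
    entry 6 c (digit_code ((1 < c) (+) odd c, odd c));
    Assign 7 (Plus (scale 4 (var 4)) (Const c)) (shift_expr c);
    Assign 9 (Plus (scale 4 (var 4)) (Const c)) (Const (odd c))].

Definition fill_tables : cmd :=
  loop (Minus (scale 2 (var 3)) (scale 4 (var 4))) (seqc [seq fill_slot c | c <- iota 0 4]).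

(** [maxn 1] counts entry 0 as filled from the start: fresh cells are 0 and the three letters fix
    the code 0, which seeds the recursion. *)
Definition tabs (m : nat) st := [/\ st 0 0 = n, st 3 0 = half, out_is [::] st &
  forall x, x < maxn 1 m ->
    [/\ st 5 x = tab 0 x, st 6 x = tab 1 x, st 7 x = tab 2 x & st 9 x = odd x :> nat]].

Lemma tab0 l : l < 3 -> tab l 0 = 0.
Proof.
move=> l3; rewrite -[RHS](decode0 r) /tab /table; congr encode.
apply/ffunP => i; case: l l3 => [|[|[|//]]] _ /=; rewrite !ffunE /nat_digit ?div0n //.
by rewrite /digit; case: insubP => [j _ _|_]; rewrite ?ffunE /nat_digit ?div0n.
Qed.

Lemma fill_slot_correct k c : c < 4 -> k < 4 ^ r ->
  triple (fun st => tabs (4 * k + c) st /\ st 4 0 = k) (fill_slot c) 5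
         (fun st => tabs (4 * k + c).+1 st /\ st 4 0 = k).
Proof.
move=> c4 kr st [[h0 h3 h2 ht] h4].
have kx : k < maxn 1 (4 * k + c) by lia.
have [t5 t6 t7 t9] := ht k kx.
set st1 := update st 5 (4 * k + c) (tab 0 (4 * k + c)).
set st2 := update st1 6 (4 * k + c) (tab 1 (4 * k + c)).
set st3 := update st2 7 (4 * k + c) (tab 2 (4 * k + c)).
set st4 := update st3 9 (4 * k + c) (odd c).
exists 5, st4; split=> //; last first.
  split=> //; split=> // x xm; have [->|ne] := eqVneq x (4 * k + c).
    by split; rewrite /st4 /st3 /st2 /st1 /update /= eqxx // oddD oddM.
  have [|e5 e6 e7 e9] := ht x; first by lia.
  by split; rewrite /st4 /st3 /st2 /st1 /update /= (negbTE ne).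
have assignE s a e f i v : eval s e = i -> eval s f = v ->
    run (Assign a e f) s 1 (update s a i v) by move=> <- <-; exact: RunAssign.
have idx s : s 4 0 = k -> eval s (Plus (scale 4 (var 4)) (Const c)) = 4 * k + c.
  by move=> e; rewrite !evalE e.
rewrite -[5]/(1 + (1 + (1 + (1 + 1)))).
apply: (@RunSeq _ _ _ _ st1).
  by apply: assignE; [exact: idx|rewrite /tab table_swap // -/tab -t5 !evalE h4].
apply: (@RunSeq _ _ _ _ st2).
  by apply: assignE; [exact: idx|rewrite /tab table_add // -/tab -t6 !evalE /st1 /update /= h4].
apply: (@RunSeq _ _ _ _ st3).
  apply: assignE; [exact: idx|rewrite /tab table_shift // -/tab -t7].
  by rewrite (@eval_shift_expr st2 c k).
apply: (@RunSeq _ _ _ _ st4); last exact: RunSkip.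
by apply: assignE; [exact: idx|].
Qed.


Lemma iota_prefix m ys x zs : iota 0 m = ys ++ x :: zs ->
  x = size ys /\ size ys < m.
Proof.
move=> e; have sm : size ys < m.
  by rewrite -(size_iota 0 m) e size_cat /=; lia.
split=> //.
by have := nth_iota 0 0 sm; rewrite e nth_cat ltnn subnn.
Qed.

Lemma fill_tables_correct : triple sized fill_tables (4 ^ r * 23 + 2) (tabs N).
Proof.
rewrite /N expnS; apply: (@triple_loop (fun k => tabs (4 * k))).
- move=> st [[h0 hb] h3]; split=> // [p|x]; first by rewrite hb.
  rewrite maxnE /= => x1; have -> : x = 0 by lia.
  by rewrite !hb // !tab0.
- by move=> k st x [h0 h3 h2 ht]; split.
- move=> k st km [_ h3 _ _] h4; rewrite !evalE h3 h4 /half; lia.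
move=> k km.
apply: (triple_weaken (triple_seqc (f := fill_slot) (xs := iota 0 4) (T := 5)
  (J := fun ys st => tabs (4 * k + size ys) st /\ st 4 0 = k) _)) => //.
- move=> ys c zs e; have [-> s4] := iota_prefix e; rewrite size_rcons addnS.
  exact: fill_slot_correct.
- by move=> st; rewrite addn0.
- by move=> st /=; rewrite mulnS addnC.
Qed.

Definition fill_flip : cmd :=
  loop (Minus (var 3) (var 4))
    (Seq (Assign 8 (var 4) (Plus (var 4) (var 3)))
         (Assign 8 (Plus (var 4) (var 3)) (var 4))).

Definition tables st := [/\ st 0 0 = n, st 3 0 = half &
  forall l x, l < 4 -> x < N -> st (5 + l) x = tab l x].

Lemma tables_update a i v st : [&& a != 0, a != 3 & (a < 5) || (8 < a)] ->
  tables st -> tables (update st a i v).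
Proof.
move=> /and3P[a0 a3' a5] [h0 h3 ht]; split.
- by rewrite /update eq_sym (negbTE a0).
- by rewrite /update eq_sym (negbTE a3').
move=> l x l4 xN; rewrite /update (_ : (5 + l == a) = false) ?ht //; lia.
Qed.

Lemma fill_flip_correct : triple (tabs N) fill_flip (half * 4 + 2)
  (fun st => tables st /\ out_is [::] st).
Proof.
pose I k st := tabs N st /\
  forall x, x < k -> st 8 x = x + half /\ st 8 (x + half) = x.
apply: (@triple_weaken (tabs N) _ (half * 4 + 2) (I half)) => //; last first.
  move=> st [[h0 h3 h2 ht] h8]; split=> //; split=> // l x l4 xN.
  have [|e5 e6 e7 _] := ht x; first by lia.
  case: l l4 => [|[|[|[|//]]]] _ //.
  have [lt|ge] := ltnP x half.
    by have [-> _] := h8 x lt; rewrite /tab; have [->] := table_flip lt.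
  have xh : x - half < half by move: xN; rewrite /N expnS /half; lia.
  have [_] := h8 _ xh; rewrite subnK // => ->.
  by have [_] := table_flip xh; rewrite -/half subnK // /tab => ->.
apply: (@triple_loop I) => [st h|k st x [[h0 h3 h2 ht] h8]|k st km [[_ h3 _ _] _] h4|k km].
- by split.
- by split.
- by rewrite !evalE h3 h4 subn_gt0.
rewrite -[2]/(1 + 1).
apply: (@triple_seq _ _ _ (fun st => [/\ I k st, st 4 0 = k & st 8 k = k + half])).
  apply: triple_assign => st [[[h0 h3 h2 ht] h8] h4]; rewrite !evalE h3 h4.
  split; [split; [by split|]|by []|by rewrite /update /= eqxx].
  move=> x xk; rewrite /update /=.
  have -> : (x == k) = false by lia.
  have -> : (x + half == k) = false by lia.
  exact: h8.
apply: triple_assign => st [[[h0 h3 h2 ht] h8] h4 h8k]; rewrite !evalE h3 h4.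
split=> //; split; first by split.
move=> x xk; rewrite /update /=.
have -> : (x == k + half) = false by lia.
have [->|ne] := eqVneq x k; first by rewrite eqxx.
have -> : (x + half == k + half) = false by lia.
by apply: h8; lia.
Qed.

(** Without multiplication, the products [x * (ml * n)] are tabulated by repeated addition. *)
Definition fill_offsets : cmd :=
  Seq (Assign 10 (Const 0) (Const 0))
    (loop (Minus (scale 4 (var 3)) (var 4))
      (Assign 10 (Plus (var 4) (Const 1))
                 (Plus (Cell 10 (var 4)) (scale ml (var 0))))).

Definition ready st := tables st /\ forall x, x <= 2 * N -> st 10 x = x * (ml * n).

Lemma ready_update a i v st : [&& a != 0, a != 3, a != 10 & (a < 5) || (8 < a)] ->
  ready st -> ready (update st a i v).
Proof.
move=> /and4P[a0 a3' a10 a5] [hs h10]; split.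
  by apply: tables_update => //; rewrite a0 a3'.
by move=> x xN; rewrite /update eq_sym (negbTE a10) h10.
Qed.

Lemma fill_offsets_correct : triple (fun st => tables st /\ out_is [::] st)
  fill_offsets (1 + (2 * N * 3 + 2)) (fun st => ready st /\ out_is [::] st).
Proof.
pose I k st := [/\ tables st, out_is [::] st &
  forall x, x <= k -> st 10 x = x * (ml * n)].
apply: (@triple_weaken (fun st => tables st /\ out_is [::] st) _
  (1 + (2 * N * 3 + 2)) (I (2 * N))) => //; last first.
  by move=> st [h1 h2 h3].
apply: (@triple_seq _ _ _ (I 0)).
  apply: triple_assign => st [hs h2]; split=> // [|x].
    exact: tables_update.
  by rewrite leqn0 => /eqP ->.
apply: (@triple_loop I) => [//|k st x [hs h2 h10]|k st km [[_ h3 _] _ _] h4|k km].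
- by split=> //; exact: tables_update.
- by rewrite !evalE h3 h4 subn_gt0 /N /half expnS; congr (_ < _); ring.
apply: triple_assign => st [[hs h2 h10] h4]; have [h0 _ _] := hs.
rewrite !evalE h4 h0; split=> //; split=> // [|x]; first exact: tables_update.
rewrite leq_eqVlt => /orP[/eqP ->|xk].
  by rewrite /update addn1 !eqxx /= h10 // mulSn addnC.
by rewrite /update addn1 [x == _]ltn_eqF //= h10.
Qed.

(** The word is known when the program is written, so acting by it is a nest of table lookups, in
    which lazy letters disappear. *)
Definition slot_word (l : seq nat) (e : expr) : expr :=
  foldr (fun l e => if l < 4 then Cell (5 + l) e else e) e l.

Lemma eval_slot_word st (l : seq nat) e v : tables st -> eval st e = v ->
  v < N -> eval st (slot_word l e) = encode (act l (decode r v)).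
Proof.
move=> [_ _ ht] ev vN; elim: l => [|a l IH] /=; first by rewrite decodeK.
case: ifP => [a4|/negbT a4].
  by rewrite evalE IH ht ?encode_lt // /tab /table encodeK.
by rewrite IH; case: a a4 => [|[|[|[|]]]].
Qed.

Definition column (w : nat) : expr := Plus (scale d (var 4)) (Const w).

Definition write_one (w i : nat) : cmd :=
  Seq (Assign 2 (Plus (Cell 10 (var 4)) (Plus (scale i (var 0)) (column w))) (Const 1))
      (Assign 2 (Plus (Cell 10 (Plus (scale 2 (var 3))
                   (slot_word (nth [::] (words t.*2) w) (var 4))))
                 (Plus (scale i (var 0)) (column w))) (Const 1)).

Definition write_slot (w : nat) : cmd :=
  IfPos (Minus (var 0) (column w)) (seqc [seq write_one w i | i <- rws w]) Skip.

Definition write_tanner : cmd :=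
  loop (Minus (scale 2 (var 3)) (var 4)) (seqc [seq write_slot w | w <- iota 0 d]).

Definition written v L st := [/\ ready st, out_is L st & st 4 0 = v].

Lemma write_one_correct v w i L : v < N ->
  triple (written v L) (write_one w i) 2
         (written v (L ++ [:: posL v w i; posR v w i])).
Proof.
move=> vN; rewrite -[2]/(1 + 1).
apply: (@triple_seq _ _ _ (written v (rcons L (posL v w i)))).
  apply: triple_assign => st [[[h0 h3 ht] h10] h2 h4].
  rewrite !evalE h4 h0 h10; last by lia.
  by rewrite [d * v]mulnC; split=> //; exact: out_is_write.
apply: triple_assign => st [[[h0 h3 ht] h10] h2 h4].
rewrite !evalE (@eval_slot_word _ _ _ v) // ?evalE //.
rewrite h4 h0 h3.
have -> : 2 * half = N by rewrite /half /N expnS; ring.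
rewrite h10; last first.
  by have := encode_lt (act (nth [::] (words t.*2) w) (decode r v)); rewrite -/N; lia.
rewrite [d * v]mulnC; split=> //.
rewrite -[L ++ _](cat_rcons _ L [:: _]) cats1; exact: out_is_write.
Qed.

Hypothesis rws_ml : forall w, size (rws w) <= ml.

Lemma write_slot_correct v w L : v < N ->
  triple (written v L) (write_slot w) (2 * ml + 2)
         (written v (L ++ ones_slot v w)).
Proof.
move=> vN; rewrite addn2; apply: triple_if.
  move=> st [h pos].
  have -> : ones_slot v w = flatten [seq [:: posL v w i; posR v w i] | i <- rws w].
    move: pos h; rewrite !evalE /ones_slot => pos [[[h0 h3 ht] h10] h2 h4].
    by move: pos; rewrite h0 h4 subn_gt0 [d * v]mulnC => ->.
  move: st h {pos}; apply: (triple_weaken (triple_seqc (f := write_one w)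
    (xs := rws w) (T := 2) (J := fun ys => written v (L ++
       flatten [seq [:: posL v w i; posR v w i] | i <- ys])) _)) => //.
  - move=> ys x zs _; rewrite map_rcons flatten_rcons catA.
    exact: write_one_correct.
  - by move=> st; rewrite cats0.
  - by rewrite ltnS mulnC leq_mul2l rws_ml.
move=> st [h z]; have -> : ones_slot v w = [::].
  move: z h; rewrite !evalE /ones_slot => z [[[h0 h3 ht] h10] h2 h4].
  by move: z; rewrite h0 h4 [d * v]mulnC => /eqP; rewrite subn_eq0 leqNgt => /negbTE ->.
by rewrite cats0; have [t' [st' [r1 l1 q1]]] := triple_skip h; exists t', st';
  split=> //; lia.
Qed.

Lemma write_tanner_correct :
  triple (fun st => ready st /\ out_is [::] st) write_tanner
    (N * (d * (2 * ml + 2)).+3 + 2)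
    (fun st => ready st /\ out_is ones_tanner st).
Proof.
pose I k st := ready st /\ out_is (flatten [seq ones_vertex v | v <- iota 0 k]) st.
apply: (@triple_loop I) => [//|k st x [h1 h2]|k st km [[[_ h3 _] _] _] h4|k km].
- by split=> //; exact: ready_update.
- by rewrite !evalE h3 h4 subn_gt0 /N /half expnS; congr (_ < _); ring.
pose L := flatten [seq ones_vertex v | v <- iota 0 k].
apply: (triple_weaken (triple_seqc (f := write_slot) (xs := iota 0 d)
  (T := 2 * ml + 2) (J := fun ys => written k (L ++
     flatten [seq ones_slot k w | w <- ys])) _)) => //.
- move=> ys x zs _; rewrite map_rcons flatten_rcons catA.
  exact: write_slot_correct.
- by move=> st [[h1 h2] h4]; rewrite cats0; split.
- move=> st [h1 h2 h4]; split=> //; split=> //.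
  by rewrite -addn1 iotaD map_cat flatten_cat /= cats0.
- by rewrite size_iota.
Qed.

(** Divides [n] by [q] through repeated subtraction: the test with [q.-1] holds while at least [q]
    is left. Each round adds [a1] rows and [a3] ones. *)
Definition write_pad : cmd :=
  Seq (Assign 11 (Const 0) (var 0))
  (Seq (Assign 12 (Const 0) (Cell 10 (scale 4 (var 3))))
  (Seq (Assign 1 (Const 0) (Const 0))
  (loop (Minus (var 11) (Const q.-1))
    (Seq (Assign 11 (Const 0) (Minus (var 11) (Const q)))
    (Seq (Assign 1 (Const 0) (Plus (var 1) (Const a1)))
      (seqc [seq Seq (Assign 2 (var 12) (Const 1))
                     (Assign 12 (Const 0) (Plus (var 12) (Const 1)))
            | _ <- iota 0 a3])))))).

Definition padding k j st := [/\ st 11 0 = n - k * q, st 1 0 = k * a1,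
  st 12 0 = 2 * N * (ml * n) + j & out_is (ones_tanner ++ ones_pad j) st].

Lemma ones_padS k : ones_pad k.+1 = rcons (ones_pad k) (2 * N * (ml * n) + k).
Proof. by rewrite /ones_pad -cats1 -[k.+1]addn1 iotaD. Qed.

Lemma write_pad_correct :
  triple (fun st => ready st /\ out_is ones_tanner st) write_pad
    (3 + (n %/ q * (a3 * 2 + 3).+2 + 2))
    (fun st => st 1 0 = n %/ q * a1 /\ out_is ones st).
Proof.
pose I k := padding k (k * a3).
apply: (@triple_weaken (fun st => ready st /\ out_is ones_tanner st) _
  (1 + (1 + (1 + (n %/ q * (a3 * 2 + 3).+2 + 2)))) (I (n %/ q))) => //; last first.
  by move=> st [h1 h2 h3 h4].
apply: (@triple_seq _ _ _ (fun st => [/\ ready st, out_is ones_tanner st & st 11 0 = n])).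
  apply: triple_assign => st [h1 h2]; have [[h0 _ _] _] := h1.
  by rewrite !evalE h0; split=> //; exact: ready_update.
apply: (@triple_seq _ _ _ (fun st => [/\ out_is ones_tanner st, st 11 0 = n &
    st 12 0 = 2 * N * (ml * n)])).
  apply: triple_assign => st [[[h0 h3 ht] h10] h2 h11]; rewrite !evalE h3.
  have -> : 4 * half = 2 * N by rewrite /half /N expnS; ring.
  by rewrite h10.
apply: (@triple_seq _ _ _ (I 0)).
  apply: triple_assign => st [h2 h11 h12]; split=> //=.
  - by rewrite /update /= h11 mul0n subn0.
  - by rewrite /update /= h12 mul0n addn0.
  - by rewrite cats0.
apply: (@triple_loop I) => [//|k st x [h1 h2 h3 h4]|k st km [h11 _ _ _] h4|k km].
- by split.
- rewrite !evalE h11 subn_gt0 -ltnS prednK // ltnS leq_subRL //.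
    by rewrite addnC -mulSn leq_divRL.
  by apply: leq_trans (leq_divM n q); rewrite leq_mul2r km orbT.
have -> : a3 * 2 + 3 = 1 + (1 + (a3 * 2).+1) by lia.
apply: (@triple_seq _ _ _ (fun st => [/\ st 11 0 = n - k.+1 * q, st 1 0 = k * a1,
  st 12 0 = 2 * N * (ml * n) + k * a3, out_is (ones_tanner ++ ones_pad (k * a3)) st
  & st 4 0 = k])).
  apply: triple_assign => st [[h11 h1 h12 h2] h4]; rewrite !evalE h11.
  by split=> //; rewrite /update /= mulSn addnC subnDA.
pose J (ys : seq nat) st := padding k.+1 (k * a3 + size ys) st /\ st 4 0 = k.
apply: (@triple_seq _ _ _ (J [::])).
  apply: triple_assign => st [h11 h1 h12 h2 h4]; rewrite !evalE h1.
  rewrite /J /padding addn0; split=> //; split=> //.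
  by rewrite /update /= mulSn addnC.
apply: (triple_weaken (triple_seqc (xs := iota 0 a3) (T := 2) (J := J) _)) => //; last first.
- by rewrite size_iota.
- by move=> st; rewrite /J /I size_iota [k.+1 * a3]mulSn [a3 + _]addnC.
move=> ys x zs _; rewrite -[2]/(1 + 1).
apply: (@triple_seq _ _ _ (fun st => [/\ st 11 0 = n - k.+1 * q, st 1 0 = k.+1 * a1,
  st 12 0 = 2 * N * (ml * n) + (k * a3 + size ys),
  out_is (ones_tanner ++ ones_pad (k * a3 + size ys).+1) st & st 4 0 = k])).
  apply: triple_assign => st [[h11 h1 h12 h2] h4]; rewrite !evalE h12.
  split=> //; apply: out_is_eq (out_is_write _ h2) => p.
  by rewrite ones_padS -rcons_cat.
apply: triple_assign => st [h11 h1 h12 h2 h4]; rewrite !evalE h12.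
rewrite /J size_rcons addnS; split=> //; split=> //.
by rewrite /update /= addn1 addnS.
Qed.

Definition build_matrix : cmd :=
  Seq find_depth (Seq fill_tables (Seq fill_flip (Seq fill_offsets
    (Seq write_tanner write_pad)))).

Definition time_factor : nat :=
  (d.+1 * (80 + 4 * (d * (2 * ml + 2)).+3 + (a3 * 2 + 3).+2)).

(** The time is linear in [n], although the matrix has more entries: cells are initially 0, and only
    the positions of ones are written. *)
Lemma build_matrix_correct : exists T st,
  [/\ run build_matrix (input_store n) T st, T <= time_factor * n.+1,
      st 1 0 = n %/ q * a1 & out_is ones st].
Proof.
have := triple_seq find_depth_correct (triple_seq fill_tables_correct
  (triple_seq fill_flip_correct (triple_seq fill_offsets_correct
  (triple_seq write_tanner_correct write_pad_correct)))).
case/(_ (input_store n) erefl) => T [st [run1 le1 [h1 h2]]].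
exists T, st; split=> //; apply: leq_trans le1 _.
have P1 : 4 ^ r <= d + n.
  have := depth_small n; rewrite -/r => h.
  by apply: leq_trans (leq_pmulr _ (_ : 0 < d)) (leq_trans h _);
    rewrite ?expn_gt0 // geq_max leq_addr leq_addl.
rewrite /half /N expnS /time_factor.
have nq : n %/ q <= n by exact: leq_div.
move: (4 ^ r) (d * (2 * ml + 2)).+3 (a3 * 2 + 3).+2 P1 => P K K' P1.
have h3 : n %/ q * K' <= n * K' by rewrite leq_mul2r nq orbT.
have h4 : P * (80 + 4 * K) <= (d + n) * (80 + 4 * K) by rewrite leq_mul2r P1 orbT.
move: h3 h4; clear; nia.
Qed.

End FixedInput.
End Construction.

(** * The matrix *)

Lemma uniq_flatten_key (X Y : eqType) (f : X -> seq Y) (key : Y -> X) (s : seq X) :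
  uniq s -> {in s, forall x, uniq (f x)} ->
  {in s, forall x, {in f x, forall p, key p = x}} ->
  uniq (flatten [seq f x | x <- s]).
Proof.
elim: s => //= x s IH /andP[xs us] uf kf; rewrite cat_uniq uf ?mem_head //=.
rewrite IH ?andbT // => [|y ys|y ys p pf]; last 2 first.
- by apply: uf; rewrite in_cons ys orbT.
- by apply: kf => //; rewrite in_cons ys orbT.
apply/hasPn => p /flatten_mapP[y ys py]; apply/negP => px.
have := kf y; rewrite in_cons ys orbT => /(_ isT p py) kp.
by move: xs; rewrite -(kf x (mem_head _ _) p px) kp ys.
Qed.

Section TannerMatrix.
Variables (t ml D q a1 a3 : nat) (nb : 'I_(8 ^ t.*2) -> {set 'I_ml}).
Local Notation d := (8 ^ t.*2)%N.
Hypothesis card_nb : forall w, #|nb w| = D.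

Definition nb_rows (w : nat) : seq nat :=
  if insub w is Some w' then [seq val i | i <- enum (nb w')] else [::].

Lemma d_gt0 : (0 < d)%N. Proof. by rewrite expn_gt0. Qed.

Definition slot (j : nat) : 'I_d := Ordinal (ltn_pmod j d_gt0).

Lemma nb_rowsE (w : 'I_d) : nb_rows w = [seq val i | i <- enum (nb w)].
Proof. by rewrite /nb_rows valK. Qed.

Lemma mem_nb_rows (w : 'I_d) (i : 'I_ml) : (val i \in nb_rows w) = (i \in nb w).
Proof. by rewrite nb_rowsE mem_map ?mem_enum //; exact: val_inj. Qed.

Lemma nb_rows_lt w i : i \in nb_rows w -> (i < ml)%N.
Proof. by rewrite /nb_rows; case: insub => // w' /mapP[k _ ->]; exact: ltn_ord. Qed.

Lemma size_nb_rows w : (w < d)%N -> size (nb_rows w) = D.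
Proof. by move=> wd; rewrite (nb_rowsE (Ordinal wd)) size_map -cardE card_nb. Qed.

Lemma uniq_nb_rows w : uniq (nb_rows w).
Proof.
rewrite /nb_rows; case: insub => // w'.
by rewrite map_inj_uniq ?enum_uniq //; exact: val_inj.
Qed.

Lemma size_nb_rows_le w : (size (nb_rows w) <= ml)%N.
Proof.
rewrite /nb_rows; case: insub => // w'; rewrite size_map -cardE.
by rewrite -[leqRHS]card_ord max_card.
Qed.

Variable n : nat.
Hypothesis n0 : (0 < n)%N.
Let r := depth t n.
Let N := (4 ^ r.+1)%N.
Local Notation vertex := {ffun 'I_r.+1 -> bool * bool}.
Let tanner := ones_tanner t ml nb_rows n.
Let allones := ones t ml q a3 nb_rows n.

Lemma ones_slotE v w p : (v * d + w < n)%N ->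
  p \in ones_slot t ml nb_rows n v w ->
  [/\ (p %% n = v * d + w)%N, ((p %/ n) %% ml \in nb_rows w)%N
    & (p %/ n %/ ml = v \/ p %/ n %/ ml = N + word_nat t n w v)%N].
Proof.
move=> vw; rewrite /ones_slot vw => /flatten_mapP[i iw].
have im := nb_rows_lt iw.
have key a : (p = a * (ml * n) + (i * n + (v * d + w)))%N ->
    [/\ (p %% n = v * d + w)%N, ((p %/ n) %% ml = i)%N & (p %/ n %/ ml = a)%N].
  move=> ->; have -> : (a * (ml * n) + (i * n + (v * d + w)) =
     (a * ml + i) * n + (v * d + w))%N by ring.
  rewrite modnMDl modn_small // divnMDl // divn_small // addn0.
  by rewrite modnMDl modn_small // divnMDl ?divn_small ?addn0 //; lia.
rewrite !inE => /orP[] /eqP /key[h1 h2 h3]; split; rewrite ?h2 //.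
  by left.
by right.
Qed.

Lemma ones_slot_nil v w : ~~ (v * d + w < n)%N -> ones_slot t ml nb_rows n v w = [::].
Proof. by rewrite /ones_slot => /negbTE ->. Qed.

Lemma word_nat_lt w v : (word_nat t n w v < N)%N.
Proof. exact: encode_lt. Qed.

Lemma uniq_ones_slot v w : (v < N)%N -> uniq (ones_slot t ml nb_rows n v w).
Proof.
move=> vN; case: (boolP (v * d + w < n)%N) => vw; last by rewrite ones_slot_nil.
rewrite /ones_slot vw; apply: (uniq_flatten_key (key := fun p => (p %/ n %% ml)%N)).
- exact: uniq_nb_rows.
- move=> i iw; have im := nb_rows_lt iw; rewrite /= inE andbT /posL /posR -/r -/N.
  apply/eqP => /eqP; rewrite eqn_add2r eqn_pmul2r; last by rewrite muln_gt0 n0; lia.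
  by move=> /eqP e; move: vN; rewrite e; lia.
move=> i iw p pi; have im := nb_rows_lt iw; move: pi.
have key a : ((a * (ml * n) + (i * n + (v * d + w))) %/ n %% ml = i)%N.
  have -> : (a * (ml * n) + (i * n + (v * d + w)) =
     (a * ml + i) * n + (v * d + w))%N by ring.
  by rewrite divnMDl // (divn_small vw) addn0 modnMDl modn_small.
by rewrite !inE => /orP[] /eqP ->; exact: key.
Qed.

Lemma ones_vertex_mod v p : p \in ones_vertex t ml nb_rows n v ->
  exists2 w, (w < d)%N & (v * d + w < n)%N /\ p \in ones_slot t ml nb_rows n v w.
Proof.
move=> /flatten_mapP[w]; rewrite mem_iota add0n => wd pw; exists w => //.
by split=> //; apply: contraLR pw => h; rewrite ones_slot_nil.
Qed.

Lemma uniq_ones_tanner : uniq tanner.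
Proof.
apply: (uniq_flatten_key (key := fun p => (p %% n %/ d)%N)); first exact: iota_uniq.
  move=> v; rewrite mem_iota add0n => vN.
  apply: (uniq_flatten_key (key := fun p => (p %% n %% d)%N)); first exact: iota_uniq.
    by move=> w _; apply: uniq_ones_slot.
  move=> w; rewrite mem_iota add0n => wd p pw.
  have vw : (v * d + w < n)%N by apply: contraLR pw => h; rewrite ones_slot_nil.
  have [-> _ _] := ones_slotE vw pw.
  by rewrite modnMDl modn_small.
move=> v _ p /ones_vertex_mod[w wd [vw pw]].
have [-> _ _] := ones_slotE vw pw.
by rewrite divnMDl ?d_gt0 // divn_small // addn0.
Qed.

Lemma tanner_lt p : p \in tanner -> (p < 2 * N * (ml * n))%N.
Proof.
move=> /flatten_mapP[v]; rewrite mem_iota add0n => vN /ones_vertex_mod[w wd [vw pw]].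
have [e1 e2 e3] := ones_slotE vw pw; have im := nb_rows_lt e2.
have ml0 : (0 < ml)%N by apply: leq_ltn_trans im.
rewrite mulnA -ltn_divLR // -ltn_divLR //.
have := word_nat_lt w v; case: e3 => ->; move: vN; rewrite -/r -/N; lia.
Qed.

Lemma uniq_ones : uniq allones.
Proof.
rewrite /allones /ones cat_uniq uniq_ones_tanner iota_uniq andbT /=.
apply/hasPn => p; rewrite mem_iota => /andP[le _].
by apply/negP => /tanner_lt; rewrite ltnNge le.
Qed.

Lemma size_ones : size allones = (2 * D * n + n %/ q * a3)%N.
Proof.
rewrite /allones /ones size_cat size_iota; congr addn.
have slotE v w : (w < d)%N ->
    size (ones_slot t ml nb_rows n v w) = (2 * D * (v * d + w < n))%N.
  move=> wd; rewrite /ones_slot; case: ifP => _; last by rewrite muln0.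
  rewrite -(size_nb_rows wd) muln1; elim: (nb_rows w) => //= i s ->; lia.
(* The difference of minima counts the columns below [n] among the first [k] slots of [v]; these
   counts telescope. *)
have vertexE v k : (k <= d)%N ->
    size (flatten [seq ones_slot t ml nb_rows n v w | w <- iota 0 k]) =
    (2 * D * (minn n (v * d + k) - minn n (v * d)))%N.
  elim: k => [|k IH] kd; first by rewrite addn0 subnn muln0.
  rewrite -addn1 iotaD map_cat flatten_cat size_cat IH; last exact: ltnW.
  rewrite /= cats0 slotE // -mulnDr; congr muln.
  by case: ltnP; lia.
have tannerE k : size (flatten [seq ones_vertex t ml nb_rows n v | v <- iota 0 k]) =
    (2 * D * minn n (k * d))%N.
  elim: k => [|k IH]; first by rewrite mul0n minn0 muln0.
  rewrite -addn1 iotaD map_cat flatten_cat size_cat IH /= cats0.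
  rewrite [size (ones_vertex _ _ _ _ _)]vertexE // -mulnDr; congr muln.
  by rewrite addn1 mulSn; lia.
rewrite tannerE; congr muln; apply/minn_idPl; exact: depthP.
Qed.

Lemma mem_ones (a : nat) (i : 'I_ml) (j : nat) : (j < n)%N -> (a < 2 * N)%N ->
  ((a * ml + i) * n + j \in allones)%N =
  (i \in nb (slot j)) &&
  ((a == j %/ d) || (a == N + word_nat t n (j %% d) (j %/ d)))%N.
Proof.
move=> jn aN; have iml := ltn_ord i.
have jdn : (j %/ d * d + j %% d = j)%N by rewrite -divn_eq.
have jdN : (j %/ d < N)%N.
  by rewrite ltn_divLR ?d_gt0 //; apply: leq_trans jn (depthP t n).
set p := (_ + j)%N.
have pmod : (p %% n = j)%N by rewrite /p modnMDl modn_small.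
have pdiv : (p %/ n = a * ml + i)%N by rewrite /p divnMDl // divn_small // addn0.
have ml0 : (0 < ml)%N by lia.
have -> : (p \in allones) = (p \in tanner).
  rewrite /allones /ones mem_cat mem_iota [X in X && _]leqNgt.
  have -> : (p < 2 * N * (ml * n))%N.
    rewrite mulnA -ltn_divLR // -ltn_divLR // pdiv divnMDl // divn_small //; lia.
  by rewrite orbF.
apply/idP/idP.
  move=> /flatten_mapP[v _ /ones_vertex_mod[w wd [vw pw]]].
  have [e1 e2 e3] := ones_slotE vw pw.
  have jE : j = (v * d + w)%N by rewrite -e1 pmod.
  have jv : (j %/ d = v)%N by rewrite jE divnMDl ?d_gt0 // divn_small // addn0.
  have jw : (j %% d = w)%N by rewrite jE modnMDl modn_small.
  have sw : val (slot j) = w by exact: jw.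
  move: e2 e3; rewrite pdiv modnMDl divnMDl // modn_small // divn_small // addn0.
  by rewrite -mem_nb_rows sw jv jw => -> /=; case=> ->; rewrite eqxx ?orbT.
move=> /andP[inb cond].
apply/flatten_mapP; exists (j %/ d)%N; first by rewrite mem_iota add0n -/r -/N.
apply/flatten_mapP; exists (j %% d)%N; first by rewrite mem_iota add0n ltn_pmod ?d_gt0.
rewrite /ones_slot jdn jn; apply/flatten_mapP; exists (val i).
  by rewrite -[(j %% d)%N]/(val (slot j)) mem_nb_rows.
rewrite !inE /posL /posR -/r -/N jdn /p.
have pE b : (b * (ml * n) + (i * n + j) = (b * ml + i) * n + j)%N by ring.
by rewrite !pE; case/orP: cond => /eqP ->; rewrite eqxx ?orbT.
Qed.

Variables (R : realType).
Let m := (n %/ q * a1)%N.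
Definition tanner_mx : 'M[R]_(n %/ q * a1, n) :=
  \matrix_(i, j) ((i * n + j)%N \in ones t ml q a3 nb_rows n)%:R.

Lemma tanner_mx_binary : binary_mx tanner_mx.
Proof. by move=> i j; rewrite mxE; case: (_ \in _); rewrite eqxx ?orbT. Qed.

Lemma tanner_mx_nnz : (2 * N * (ml * n) + n %/ q * a3 <= m * n)%N ->
  nnz tanner_mx = (2 * D * n + n %/ q * a3)%N.
Proof.
move=> fit; rewrite -size_ones /nnz cardE.
pose h (p : 'I_m * 'I_n) := (p.1 * n + p.2)%N.
have hI : injective h.
  move=> [i j] [i' j'] /= e.
  have e1 : i = i' :> nat.
    by have := congr1 (fun x => x %/ n)%N e; rewrite /h /= !divnMDl // !divn_small // !addn0.
  have e2 : j = j' :> nat.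
    by have := congr1 (fun x => x %% n)%N e; rewrite /h /= !modnMDl !modn_small.
  by congr (_, _); apply: val_inj.
rewrite -(size_map h); apply: perm_size; apply: uniq_perm.
- by rewrite map_inj_uniq // enum_uniq.
- exact: uniq_ones.
move=> x; apply/mapP/idP => [[p]|xo].
  rewrite mem_enum inE mxE => + -> /=; rewrite /h -/allones.
  by case: (_ \in _) => //; rewrite eqxx.
have xmn : (x < m * n)%N.
  apply: leq_trans fit; move: xo; rewrite /allones /ones mem_cat => /orP[/tanner_lt|].
    by move=> lt; apply: leq_trans lt (leq_addr _ _).
  by rewrite mem_iota => /andP[_].
have xi : (x %/ n < m)%N by rewrite ltn_divLR.
have xj : (x %% n < n)%N by rewrite ltn_pmod.
exists (Ordinal xi, Ordinal xj); last by rewrite /h /= -divn_eq.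
by rewrite mem_enum inE mxE /= -divn_eq -/allones xo oner_neq0.
Qed.

(** The edges without a column are restored as zero coordinates: [X] extends [x] along the injection
    [phi]. Rows outside the blocks only increase the norm of the measurements, and
    [2 * (1/15) <= 1/4]. *)
Lemma tanner_mx_nsp (k : nat) (delta tau : R) : (2 * N * ml <= m)%N ->
  0 <= delta -> (0 < k)%N -> 2 * delta * d%:R ^+ 2 <= k%:R ^+ 2 ->
  gap R ^+ t * 2 * d%:R <= k%:R ->
  0 <= tau -> local_nsp (fun i w => i \in nb w) k (1 / 15) tau ->
  robust_nsp tanner_mx (Num.truncn (delta * n%:R)) tau.
Proof.
move=> fit d0 k0 kd gk tau0 lnsp x S Ss.
have jdN (j : 'I_n) : (j %/ d < N)%N.
  by rewrite ltn_divLR ?d_gt0 //; apply: leq_trans (ltn_ord j) (depthP t n).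
pose phi (j : 'I_n) : vertex * 'I_d := (decode r (j %/ d), slot j).
have phiI : injective phi.
  move=> i j [/(congr1 (@encode r))]; rewrite !decodeK ?jdN // => e1 e2.
  by apply: val_inj; rewrite /= (divn_eq i d) (divn_eq j d) e1 e2.
pose X (e : vertex * 'I_d) : R := \sum_(j | phi j == e) x j 0.
have Xphi j : X (phi j) = x j 0.
  by rewrite /X (big_pred1 j) // => i; rewrite /= (inj_eq phiI).
have X0 e : e \notin codom phi -> X e = 0.
  move=> ne; rewrite /X big_pred0 // => j; apply: contraNF ne => /eqP <-.
  exact: codom_f.
have sumX (F : vertex * 'I_d -> R -> R) : (forall e, F e 0 = 0) ->
    \sum_e F e (X e) = \sum_j F (phi j) (x j 0).
  move=> F0; rewrite (bigID (mem (codom phi))) /= [X in _ + X]big1 ?addr0; last first.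
    by move=> e /X0 ->.
  transitivity (\sum_(e in phi @: setT) F e (X e)).
    apply: eq_bigl => e; apply/codomP/imsetP => [[j ->]|[j _ ->]]; by exists j.
  rewrite big_imset /=; last by move=> ? ? _ _; exact: phiI.
  by rewrite big_mkcond /=; apply: eq_bigr => j _; rewrite inE Xphi.
have S1 : \sum_(e in phi @: S) `|X e| = \sum_(j in S) `|x j 0|.
  rewrite big_imset /=; last by move=> ? ? _ _; exact: phiI.
  by apply: eq_bigr => j _; rewrite Xphi.
have S2 : \sum_e `|X e| = l1norm x.
  by rewrite (sumX (fun _ y => `|y|)) // => e; rewrite normr0.
have sp (S' : {set vertex * 'I_d}) : S' \subset phi @: S ->
   (2 * #|S'| <= k * (#|fst @: S'| + #|(fun e => word_act e.2 e.1) @: S'|))%N.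
  move=> sS'; apply: (@expander_sparse R r t k delta) => //.
  apply: le_trans (_ : delta * n%:R <= _).
    apply: le_trans (_ : (Num.truncn (delta * n%:R))%:R <= _).
      rewrite ler_nat; apply: leq_trans (subset_leq_card sS') _.
      by rewrite card_imset.
    by rewrite truncn_le // mulr_ge0 // ler0n.
  by rewrite ler_wpM2l // ler_nat; exact: depthP.
have := tanner_nsp (@word_act_inj r t) X lnsp sp; rewrite S1 S2 => h.
apply: le_trans h _.
have ge := l1norm_ge0 x.
suff rows : \sum_v \sum_i `|\sum_w (i \in nb w)%:R * X (v, w)| +
     \sum_u \sum_i `|\sum_(e | word_act e.2 e.1 == u) (i \in nb e.2)%:R * X e| <=
     l1norm (tanner_mx *m x).
  by apply: lerD; [lra|rewrite ler_wpM2l].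
have rowP (b : bool) (v : vertex) (i : 'I_ml) :
    (((if b then N else 0) + encode v) * ml + i < m)%N.
  apply: leq_trans fit; have := encode_lt v; rewrite -/N => lt.
  have : ((if b then N else 0) + encode v < 2 * N)%N by case: b; lia.
  move=> lt2; apply: leq_trans (_ : ((if b then N else 0) + encode v).+1 * ml <= _)%N.
    by rewrite mulSn addnC ltn_add2r.
  by rewrite leq_mul2r lt2 orbT.
pose row (e : bool * vertex * 'I_ml) : 'I_m := Ordinal (rowP e.1.1 e.1.2 e.2).
have rowI : injective row.
  move=> [[b v] i] [[b' v'] i'] /(congr1 val) /= e.
  have ml0 : (0 < ml)%N by apply: leq_ltn_trans (ltn_ord i).
  have ei : i = i' :> nat.
    by have := congr1 (fun y => y %% ml)%N e; rewrite /= !modnMDl !modn_small.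
  have ea : ((if b then N else 0) + encode v = (if b' then N else 0) + encode v')%N.
    have := congr1 (fun y => y %/ ml)%N e; rewrite /= !divnMDl // !divn_small //.
    by rewrite !addn0.
  have l1 := encode_lt v; have l2 := encode_lt v'; rewrite -/N in l1 l2.
  have eb : b = b' by move: ea; case: (b); case: (b') => // ?; exfalso; lia.
  rewrite eb in ea *; move/addnI: ea => /(can_inj (@encodeK r)) ->.
  by congr (_, _, _); apply: val_inj.
have rowE b v i : (tanner_mx *m x) (row (b, v, i)) 0 = if b
    then \sum_(e | word_act e.2 e.1 == v) (i \in nb e.2)%:R * X e
    else \sum_w (i \in nb w)%:R * X (v, w).
  have lt : ((if b then N else 0) + encode v < 2 * N)%N.
    by have := encode_lt v; rewrite -/N; case: (b); lia.
  rewrite mxE; under eq_bigr => j _ do rewrite mxE /= -/allones mem_ones //.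
  case: b lt => lt.
    rewrite [RHS]big_mkcond /=.
    have F0 (e : vertex * 'I_d) :
        (if word_act e.2 e.1 == v then (i \in nb e.2)%:R * 0 else 0) = 0 :> R.
      by rewrite mulr0 if_same.
    have /= -> := sumX (fun e y => if word_act e.2 e.1 == v
      then (i \in nb e.2)%:R * y else 0) F0.
    apply: eq_bigr => j _ /=.
    have -> : (N + encode v == j %/ d)%N = false by have := jdN j; lia.
    rewrite eqn_add2l /= /word_nat (can_eq (@encodeK r)) /word_act eq_sym.
    by case: eqP => _; rewrite ?andbT ?andbF ?mul0r.
  have -> : \sum_w (i \in nb w)%:R * X (v, w) =
      \sum_e (if e.1 == v then (i \in nb e.2)%:R * X e else 0).
    rewrite sum_pair (bigD1 v) //= [X in _ + X]big1 ?addr0.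
      by apply: eq_bigr => w _; rewrite eqxx.
    by move=> u /negbTE ne; apply: big1 => w _; rewrite ne.
  have F0 (e : vertex * 'I_d) :
      (if e.1 == v then (i \in nb e.2)%:R * 0 else 0) = 0 :> R.
    by rewrite mulr0 if_same.
  have /= -> := sumX (fun e y => if e.1 == v then (i \in nb e.2)%:R * y else 0) F0.
  apply: eq_bigr => j _ /=; rewrite add0n.
  have -> : (encode v == N + word_nat t n (j %% d) (j %/ d))%N = false.
    by have := encode_lt v; rewrite -/N; lia.
  rewrite orbF -[(j %/ d)%N in LHS](decodeK (jdN j)) (can_eq (@encodeK r)) eq_sym.
  by case: eqP => _; rewrite ?andbT ?andbF ?mul0r.
have -> : \sum_v \sum_i `|\sum_w (i \in nb w)%:R * X (v, w)| +
     \sum_u \sum_i `|\sum_(e | word_act e.2 e.1 == u) (i \in nb e.2)%:R * X e| =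
     \sum_e `|(tanner_mx *m x) (row e) 0|.
  rewrite sum_pair sum_pair /= big_bool addrC; congr (_ + _).
    by apply: eq_bigr => v _; apply: eq_bigr => i _; rewrite rowE.
  by apply: eq_bigr => v _; apply: eq_bigr => i _; rewrite rowE.
rewrite /l1norm [leRHS](bigID (mem (row @: setT))) /= big_imset /=; last first.
  by move=> ? ? _ _; exact: rowI.
rewrite [X in _ <= X + _](eq_bigl predT) => [|e]; last by rewrite inE.
by rewrite lerDl sumr_ge0.
Qed.

End TannerMatrix.

(** * Choice of the parameters *)

Lemma gap_pow_small (R : realType) (y : R) : 0 < y -> exists t, gap R ^+ t <= y.
Proof.
move=> y0; pose s := 2432 * `|ln y|; exists (Num.truncn s).+1; set t := _.+1.
have ts : s < t%:R by exact: truncnS_gt.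
apply: le_trans (_ : expR (- (1 / 2432)) ^+ t <= _).
  rewrite lerXn2r ?nnegrE ?expR_ge0 //; first by rewrite /gap; lra.
  by apply: le_trans (expR_ge1Dx _); rewrite /gap.
rewrite -expRM_natl -[leRHS](@lnK R) ?posrE // ler_expR.
by have := ler_norm (- ln y); rewrite normrN; move: ts; rewrite /s; lra.
Qed.

Lemma truncn_approx (R : realType) (al e : R) : 0 < al -> 0 < e ->
  exists Q, forall q : nat, (Q <= q)%N ->
  (1 - e) * al * q%:R <= (Num.truncn (al * q%:R))%:R <= al * q%:R.
Proof.
move=> al0 e0; exists (Num.truncn (1 / (e * al))).+1 => q Qq.
have aq0 : 0 <= al * q%:R by rewrite mulr_ge0 ?ler0n // ltW.
have eq1 : 1 <= e * al * q%:R.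
  rewrite -ler_pdivrMl ?mulr_gt0 //; apply: ltW.
  apply: lt_le_trans (_ : (Num.truncn (1 / (e * al))).+1%:R <= _).
    by rewrite mulrC; exact: truncnS_gt.
  by rewrite ler_nat.
rewrite truncn_le aq0 andbT.
have := truncnS_gt (al * q%:R); rewrite -natr1; lra.
Qed.

(** The summand 4 in [g] absorbs the truncation and ensures [e^g >= e^3 / delta], enough for the
    hypothesis [dK] of the random construction. The factor 12 comes from [K = 2 k + 1 <= 3 k],
    [k <= 2 sd d] and [sd <= 2 sqrt(delta)]. *)
Lemma local_code_exists (R : realType) (delta : R) (C1 : nat) :
  0 < delta < 1 -> expR 32 <= C1%:R :> R ->
  let g := (Num.truncn (ln (1 / delta)) + 4)%N in
  exists (t k ml : nat) (nb : 'I_(8 ^ t.*2) -> {set 'I_ml}),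
  [/\ forall w, #|nb w| = (32 * g)%N,
      local_nsp (fun i w => i \in nb w) k (1 / 15 : R) (16 / (15 * (32 * g)%:R)),
      (0 < k)%N /\ 2 * delta * (8 ^ t.*2)%:R ^+ 2 <= k%:R ^+ 2,
      gap R ^+ t * 2 * (8 ^ t.*2)%:R <= k%:R &
      ml%:R <= 12 * (32 * (C1%:R * g%:R * Num.sqrt delta * (8 ^ t.*2)%:R))].
Proof.
move=> /andP[d0 d1] hC g.
pose sd := Num.sqrt (2 * delta).
have sd0 : 0 < sd by rewrite sqrtr_gt0 mulr_gt0.
have sd2 : sd ^+ 2 = 2 * delta by rewrite sqr_sqrtr // mulr_ge0 // ltW.
have [t gt] := @gap_pow_small R (sd / 2) (divr_gt0 sd0 (ltr0n R 2)).
pose d := (8 ^ t.*2)%N; have dR : 0 < d%:R :> R by rewrite ltr0n expn_gt0.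
pose k := (Num.truncn (sd * d%:R)).+1; pose K := (2 * k).+1.
have kge : sd * d%:R <= k%:R by rewrite ltW // truncnS_gt.
(* Since [64 * gap >= 1], also [gap^t d >= 1], and the choice of [t] makes [sd * d] large; hence
   rounding up in [k] costs at most a factor 2. *)
have sdd : 1 <= sd * d%:R.
  have gd : 1 <= gap R ^+ t * d%:R.
    rewrite /d natrX -mul2n exprM -exprMn; apply: exprn_ege1.
    by rewrite /gap expr2; lra.
  have gd2 : gap R ^+ t * d%:R <= sd / 2 * d%:R by rewrite ler_wpM2r // ltW.
  by lra.
have kle : k%:R <= 2 * (sd * d%:R).
  rewrite /k -natr1; have : (Num.truncn (sd * d%:R))%:R <= sd * d%:R.
    by rewrite truncn_le // mulr_ge0 // ltW.
  by lra.
have g0 : (0 < g)%N by rewrite /g addn4.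
have K0 : (0 < K)%N by [].
have KE : K%:R = 2 * k%:R + 1 :> R by rewrite /K -addn1 natrD natrM.
have gL : ln (1 / delta) + 3 <= g%:R.
  have := truncnS_gt (ln (1 / delta)); rewrite /g -natr1 natrD; lra.
have KM : expR 32 * K%:R <= (C1 * K)%:R :> R by rewrite natrM ler_wpM2r // ler0n.
have dK : 4 * expR 1 * d%:R <= K%:R * expR g%:R :> R.
  have K2 : 2 * (sd * d%:R) <= K%:R by rewrite KE; lra.
  have eg : expR 3 / delta <= expR g%:R.
    have -> : expR 3 / delta = expR (ln (1 / delta) + 3).
      by rewrite expRD lnK ?posrE ?divr_gt0 // mulrC mul1r.
    by rewrite ler_expR.
  have sdel : delta <= sd.
    by rewrite -(@ler_pXn2r R 2) ?nnegrE ?(ltW d0) ?(ltW sd0) // sd2; nra.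
  apply: le_trans (_ : 2 * (sd * d%:R) * (expR 3 / delta) <= _); last first.
    have p1 : 0 <= 2 * (sd * d%:R) by rewrite mulr_ge0 // mulr_ge0 // ltW.
    have p2 : 0 <= expR 3 / delta by rewrite divr_ge0 ?expR_ge0 // ltW.
    exact: ler_pM.
  have -> : expR 3 = expR 1 * expR 2 :> R by rewrite -expRD; congr expR; ring.
  have e2 : 3 <= expR 2 :> R by have := @expR_ge1Dx R 2; lra.
  have e1 : 0 < expR 1 :> R by exact: expR_gt0.
  have -> : 2 * (sd * d%:R) * (expR 1 * expR 2 / delta) =
     (expR 1 * d%:R) * (2 * expR 2 * (sd / delta)) by ring.
  have sdd1 : 1 <= sd / delta by rewrite ler_pdivlMr // mul1r.
  rewrite -mulrA [4 * _]mulrC.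
  rewrite ler_wpM2l ?mulr_ge0 ?ler0n ?(ltW e1) //.
  by nra.
have [nb [cnb ex]] := @random_expander R d g K (C1 * K) g0 K0 KM dK.
exists t, k, (32 * g * (C1 * K))%N, nb; split=> //.
- by apply: expander_nsp => //; rewrite muln_gt0 g0.
- split=> //; rewrite -sd2 -exprMn ler_pXn2r ?nnegrE ?ler0n // mulr_ge0 ?ler0n //.
  exact: ltW.
- apply: le_trans kge; rewrite ler_wpM2r ?ler0n //; lra.
have s2 : sd <= 2 * Num.sqrt delta.
  rewrite /sd sqrtrM // ler_wpM2r ?sqrtr_ge0 //.
  by rewrite -(@ler_pXn2r R 2) ?nnegrE ?sqrtr_ge0 // sqr_sqrtr //; lra.
have Kle : K%:R <= 12 * Num.sqrt delta * d%:R.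
  rewrite KE.
  have : sd * d%:R <= 2 * Num.sqrt delta * d%:R by rewrite ler_wpM2r // ler0n.
  have : 1 <= k%:R :> R by rewrite ler1n.
  by lra.
rewrite !natrM.
have -> : 12 * (32 * (C1%:R * g%:R * Num.sqrt delta * d%:R)) =
   32 * g%:R * C1%:R * (12 * Num.sqrt delta * d%:R) :> R by ring.
by rewrite mulrA ler_wpM2l ?mulr_ge0 ?ler0n.
Qed.

Lemma linear_le_pow (C : nat) : exists k, forall n, (2 <= n)%N ->
  (C * n.+1 <= n ^ k + k)%N.
Proof.
exists C.+3 => n n2; apply: leq_trans (leq_addr _ _).
have h : (C.+1 <= n ^ C.+1)%N.
  by apply: ltnW; apply: leq_ltn_trans (leqnn _) (ltn_expl _ _).
apply: leq_trans (_ : n * (2 * C.+1) <= _)%N; first by nia.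
by rewrite !(expnS n _.+1) leq_mul // leq_mul.
Qed.

Lemma le_of_truncn (R : realType) (y : R) n : ((Num.truncn y).+1 <= n)%N -> y <= n%:R.
Proof.
by move=> h; apply: ltW; apply: lt_le_trans (truncnS_gt y) _; rewrite ler_nat.
Qed.

(** Approximates a real multiple of [n] with two integers fixed in advance. One factor [1 - e] is
    lost in rounding [al * q], another in rounding [n] to a multiple of [q]. *)
Lemma floor_multiple (R : realType) (al e : R) (n q a : nat) :
  0 <= al -> 0 <= e <= 1 -> (0 < q)%N -> q%:R <= e * n%:R ->
  (1 - e) * al * q%:R <= a%:R <= al * q%:R ->
  (1 - 2 * e) * (al * n%:R) <= (n %/ q * a)%:R <= al * n%:R.
Proof.
move=> al0 /andP[e0 e1] q0 qn /andP[al_ au]; rewrite natrM.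
set z : R := (n %/ q)%:R.
have z0 : 0 <= z by [].
have z1 : z * q%:R <= n%:R by rewrite -natrM ler_nat leq_divM.
have z2 : n%:R <= z * q%:R + q%:R.
  by rewrite -natrM -natrD ler_nat ltnW // -mulSnr ltn_ceil.
have z3 : (1 - e) * n%:R <= z * q%:R by lra.
apply/andP; split.
  apply: le_trans (ler_wpM2l z0 al_).
  have -> : z * ((1 - e) * al * q%:R) = (1 - e) * al * (z * q%:R) by ring.
  apply: le_trans (ler_wpM2l _ z3); last by rewrite mulr_ge0 // subr_ge0.
  have : 0 <= e ^+ 2 * (al * n%:R) by rewrite mulr_ge0 ?mulr_ge0 ?sqr_ge0.
  by nra.
apply: le_trans (ler_wpM2l z0 au) _.
have -> : z * (al * q%:R) = al * (z * q%:R) by ring.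
by rewrite ler_wpM2l.
Qed.

(** The blocks use at most [8 w n] rows, for two sides and the factor 4 lost in [depth]. At least
    [16 w n] rows are available, and the other [8 w n] have room for the padding. *)
Lemma tanner_fits (R : realType) (t ml q a1 a3 n : nat) (w al3 : R) :
  0 < w -> (8 ^ t.*2 <= n)%N -> ml%:R <= w * (8 ^ t.*2)%:R ->
  1 / 2 * (32 * w * n%:R) <= (n %/ q * a1)%:R ->
  (n %/ q * a3)%:R <= al3 * n%:R -> al3 <= 8 * w * n%:R ->
  (2 * 4 ^ (depth t n).+1 * ml <= n %/ q * a1)%N /\
  (2 * 4 ^ (depth t n).+1 * (ml * n) + n %/ q * a3 <= n %/ q * a1 * n)%N.
Proof.
move=> w0 dn mlw mge a3le al3n.
have P : (4 ^ depth t n * 8 ^ t.*2)%:R <= n%:R :> R.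
  by rewrite ler_nat; apply: leq_trans (depth_small t n) _; rewrite geq_max dn leqnn.
have h : (2 * 4 ^ (depth t n).+1 * ml)%:R <= 8 * w * n%:R :> R.
  rewrite expnS !natrM in P *.
  have : (4 ^ depth t n)%:R * ml%:R <= (4 ^ depth t n)%:R * (w * (8 ^ t.*2)%:R).
    by rewrite ler_wpM2l.
  have : w * ((4 ^ depth t n)%:R * (8 ^ t.*2)%:R) <= w * n%:R.
    by rewrite ler_wpM2l // ltW.
  by lra.
have n_ge0 : 0 <= n%:R :> R by [].
have wn : 0 <= w * n%:R by rewrite mulr_ge0 // ltW.
split; first by rewrite -(ler_nat R); lra.
rewrite -(ler_nat R) natrD mulnA natrM [leRHS]natrM.
have h1 := ler_wpM2r n_ge0 h; have h2 := ler_wpM2r n_ge0 mge.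
have h3 := ler_wpM2r n_ge0 al3n.
by lra.
Qed.

Lemma sum_leq (a b c d n : nat) : (2 + a + b + c + d <= n)%N ->
  [/\ 2 <= n, a <= n, b <= n, c <= n & d <= n]%N.
Proof. by move=> h; split; lia. Qed.

Lemma eq_upto_weaken (R : realType) (e eps v : R) (k : nat) :
  2 * e <= eps -> 0 <= v -> (1 - 2 * e) * v <= k%:R <= v -> eq_upto eps k v.
Proof.
move=> ee v0 /andP[l u]; rewrite /eq_upto u andbT; apply: le_trans l.
by rewrite ler_wpM2r //; lra.
Qed.

Lemma eq_upto_add (R : realType) (e eps v : R) (b k : nat) :
  0 <= e -> 2 * e <= eps -> 0 <= v -> (1 - 2 * e) * v <= k%:R <= v ->
  eq_upto eps (b + k) (b%:R + v).
Proof.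
move=> e0 ee v0 /andP[l u]; apply: (eq_upto_weaken ee); first exact: addr_ge0.
rewrite natrD lerD2l u andbT.
have : 0 <= 2 * e * b%:R by rewrite !mulr_ge0.
by lra.
Qed.

Theorem theorem1 (R : realType) (delta1 : R) (hdelta1 : 0 < delta1 < 1) :
  exists c c' : R, 0 < c /\ 0 < c' /\
  forall delta eps : R, 0 < delta <= delta1 -> 0 < eps ->
  exists (n0 : nat) (m : nat -> nat) (A : forall n : nat, 'M[R]_(m n, n)),
    poly_time_constructible n0 A /\
    (forall n : nat, (n0 <= n)%N ->
      binary_mx (A n) /\
      eq_upto eps (m n) (c * Num.sqrt delta * ln (1 / delta) * n%:R) /\
      eq_upto eps (nnz (A n)) (c' * ln (1 / delta) * n%:R)) /\
    exists C1 C2 : R, 0 < C1 /\ 0 < C2 /\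
      forall n : nat, (n0 <= n)%N ->
      (1 <= Num.truncn (delta * n%:R))%N /\
      forall eta : R, 0 <= eta ->
      solved_by_l1_minimization C1 C2 (A n) (Num.truncn (delta * n%:R)) eta.
Proof.
have /andP[d10 d11] := hdelta1.
pose L1 := ln (1 / delta1).
have L10 : 0 < L1 by rewrite ln_gt0 // ltr_pdivlMr // mul1r.
pose Ce := (Num.truncn (expR 32 : R)).+1.
have hCe : expR 32 <= Ce%:R :> R by rewrite ltW // truncnS_gt.
have Ce0 : 0 < Ce%:R :> R by rewrite ltr0n.
(* [g] exceeds [L] by at most 4 and [L >= L1], so [g <= kap * L]; this is where [delta1 < 1] makes
   the constants uniform in [delta]. *)
pose kap := 1 + 4 / L1.
have kap0 : 0 < kap by rewrite addr_gt0 // divr_gt0.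
have [cc cc0 ccE] : exists2 cc : R, 0 < cc & cc = 12 * (32 * (kap * Ce%:R)).
  by exists (12 * (32 * (kap * Ce%:R))) => //; rewrite !pmulr_rgt0 // ltr0n.
(* Half of the [32 w n] rows survive rounding, as [tanner_fits] requires. The graph uses at most
   [2 * (32 * kap) * L] ones per column; the factor 4 leaves a positive remainder [al3] for the
   padding. *)
exists (32 * cc), (4 * (32 * kap)).
split; first by rewrite pmulr_rgt0 // ltr0n.
split; first by rewrite !pmulr_rgt0 // ltr0n.
move=> delta eps /andP[dl0 dle] eps0.
have dl1 : delta < 1 by apply: le_lt_trans d11.
set L := ln (1 / delta).
have LL1 : L1 <= L.
  by rewrite ler_ln ?posrE ?divr_gt0 // ler_pM2l // lef_pV2 ?posrE.
have L0 : 0 < L by apply: lt_le_trans LL1.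
have dl01 : 0 < delta < 1 by rewrite dl0 dl1.
have [t [k [ml [nb [cnb lnsp [k0 kd] gk mlb]]]]] := local_code_exists dl01 hCe.
move: cnb lnsp mlb; set g := (Num.truncn (ln (1 / delta)) + 4)%N => cnb lnsp mlb.
have gk2 : g%:R <= kap * L.
  have h1 : (Num.truncn L)%:R <= L by rewrite truncn_le // ltW.
  have h2 : 4 <= 4 / L1 * L.
    by rewrite mulrAC ler_pdivlMr // ler_pM2l.
  have gE : g%:R = (Num.truncn L)%:R + 4 :> R by rewrite /g natrD.
  by rewrite gE /kap mulrDl mul1r; lra.
pose d := (8 ^ t.*2)%N.
have dR : 0 < d%:R :> R by rewrite ltr0n expn_gt0.
set sq := Num.sqrt delta; have sq0 : 0 < sq by rewrite sqrtr_gt0.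
pose w := cc * sq * L; pose al1 := 32 * w.
have w0 : 0 < w by exact: mulr_gt0 (mulr_gt0 cc0 sq0) L0.
have al1E : 32 * cc * sq * L = al1 by rewrite /al1 /w !mulrA.
have mlw : ml%:R <= w * d%:R.
  apply: le_trans mlb _; rewrite -/d -/sq /w ccE.
  have h : g%:R * (Ce%:R * sq * d%:R) <= kap * L * (Ce%:R * sq * d%:R).
    by rewrite ler_wpM2r // !mulr_ge0 // ltW.
  by lra.
pose al3 := 4 * (32 * kap) * L - 2 * (32 * g)%:R.
have al10 : 0 < al1 by rewrite pmulr_rgt0 // ltr0n.
have kL0 : 0 < kap * L by rewrite mulr_gt0.
have al30 : 0 < al3 by rewrite /al3 natrM; lra.
(* Two roundings lose [2 * e <= eps], and [e <= 1/4] keeps at least half of the rows. *)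
pose e := Num.min eps (1 / 2) / 2.
have e0 : 0 < e by rewrite divr_gt0 // lt_min eps0 divr_gt0.
have e2 : 2 * e <= eps by rewrite /e mulrC divfK // ge_min lexx.
have e3 : e <= 1 / 4.
  have : Num.min eps (1 / 2) <= 1 / 2 by rewrite ge_min lexx orbT.
  by rewrite /e; lra.
have [Q1 hQ1] := truncn_approx al10 e0.
have [Q3 hQ3] := truncn_approx al30 e0.
pose q := (maxn 1 (maxn Q1 Q3)).
have q0 : (0 < q)%N by rewrite leq_max.
have qR : 0 < q%:R :> R by rewrite ltr0n.
pose a1 := Num.truncn (al1 * q%:R); pose a3 := Num.truncn (al3 * q%:R).
have /andP[a1l a1u] : (1 - e) * al1 * q%:R <= a1%:R <= al1 * q%:R.
  by apply: hQ1; rewrite !leq_max leqnn orbT.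
have /andP[a3l a3u] : (1 - e) * al3 * q%:R <= a3%:R <= al3 * q%:R.
  by apply: hQ3; rewrite !leq_max leqnn !orbT.
pose n0 := (2 + d + (Num.truncn (q%:R / e)).+1 + (Num.truncn (al3 / (8 * w))).+1
  + (Num.truncn (1 / delta)).+1)%N.
pose rws := nb_rows nb.
exists n0, (fun n => n %/ q * a1)%N, (fun n => tanner_mx q a1 a3 nb n R).
have facts n : (n0 <= n)%N ->
  [/\ (0 < n)%N, (2 * 4 ^ (depth t n).+1 * ml <= n %/ q * a1)%N,
   (2 * 4 ^ (depth t n).+1 * (ml * n) + n %/ q * a3 <= n %/ q * a1 * n)%N,
   (1 - 2 * e) * (al1 * n%:R) <= (n %/ q * a1)%:R <= al1 * n%:R &
   (1 - 2 * e) * (al3 * n%:R) <= (n %/ q * a3)%:R <= al3 * n%:R].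
  move=> hn; have [n2 dn n3 n4 _] := sum_leq hn.
  have qn : q%:R <= e * n%:R.
    by rewrite -ler_pdivrMl // mulrC; exact: le_of_truncn.
  have e01 : 0 <= e <= 1 by rewrite (ltW e0) /=; lra.
  have b1 := @floor_multiple R al1 e n q a1 (ltW al10) e01 q0 qn
    (introT andP (conj a1l a1u)).
  have b3 := @floor_multiple R al3 e n q a3 (ltW al30) e01 q0 qn
    (introT andP (conj a3l a3u)).
  have nb3 : al3 <= 8 * w * n%:R.
    have : al3 / (8 * w) <= n%:R by exact: le_of_truncn.
    by rewrite ler_pdivrMr ?pmulr_rgt0 // mulrC.
  have half_m : 1 / 2 * (32 * w * n%:R) <= (n %/ q * a1)%:R.
    have /andP[b1l _] := b1; apply: le_trans b1l; rewrite -/al1.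
    by rewrite ler_wpM2r ?mulr_ge0 ?(ltW al10) //; lra.
  have [f1 f2] := tanner_fits w0 dn mlw half_m (proj2 (andP b3)) nb3.
  by split=> //; exact: ltnW.
split.
  have [kk hkk] := linear_le_pow (time_factor t ml a3).
  exists (build_matrix t ml q a1 a3 rws), kk => n hn.
  have [T [st [run1 le1 h1 h2]]] := @build_matrix_correct t ml q a1 a3 rws q0 n (size_nb_rows_le nb).
  exists T, st; split=> //.
    by have [n2 _ _ _ _] := sum_leq hn; exact: leq_trans le1 (hkk _ n2).
  split=> // i j; rewrite mxE h2 //.
split.
  move=> n hn; have [n_gt0 fit1 fit2 b1 b3] := facts n hn.
  split; first exact: tanner_mx_binary.
  have nR : 0 <= n%:R :> R by [].
  split.
    rewrite -/sq -/L al1E; apply: (eq_upto_weaken e2) b1.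
    by rewrite mulr_ge0 // ltW.
  rewrite (@tanner_mx_nnz t ml (32 * g) q a1 a3 nb cnb n n_gt0 R fit2).
  have -> : 4 * (32 * kap) * L * n%:R =
      (2 * (32 * g) * n)%:R + al3 * n%:R.
    by rewrite /al3 mulrBl !natrM addrC subrK.
  by apply: (eq_upto_add _ (ltW e0) e2) b3; rewrite mulr_ge0 // ltW.
exists 4, (8 * (16 / (15 * (32 * g)%:R))).
split=> //; split.
  by rewrite mulr_gt0 // divr_gt0 // mulr_gt0 // ltr0n muln_gt0 /g addn4.
move=> n hn; have [n_gt0 fit1 fit2 b1 b3] := facts n hn.
split.
  have [_ _ _ _ n5] := sum_leq hn.
  by rewrite truncn_gt0 -ler_pdivrMl // mulrC; exact: le_of_truncn.
move=> eta eta0; apply: robust_nsp_solved; first by rewrite divr_ge0 // mulr_ge0.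
by apply: (@tanner_mx_nsp t ml q a1 a3 nb n n_gt0 R k delta) => //; exact: ltW.
Qed.
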